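(* Let $c>0$ and choose $\lambda_k=t_k$ and $M_k=\lceil k/c\rceil$ for all $k\in\mathbb N$. Then, for every iteration $n$ of the algorithm FGFD described in the context, with $g_n=\nabla\mathcal R(h_n)$, $$\mathbb E_n\big[\|\hat g_n\|_C^2\big]\le 2(1+2c)\,\|g_n\|^2 .$$
   Context: $\mathcal H$ is a real, separable, infinite-dimensional Hilbert space with inner product $\langle\cdot,\cdot\rangle$ and norm $\|\cdot\|$. $\mathcal R:\mathcal H\to\mathbb R$ is Fréchet differentiable, with gradient $\nabla\mathcal R(h)\in\mathcal H$ (Riesz representer of the derivative) and directional derivative $D\mathcal R(h;v)=\langle\nabla\mathcal R(h),v\rangle$. $\mathbb N=\{1,2,\dots\}$. A pre-basis $\{b_1,b_2,\dots\}\subset\mathcal H$ is a linearly independent set with dense span; fix one and let $\{e_1,e_2,\dots\}$ be its Gram–Schmidt orthonormalization (an orthonormal basis of $\mathcal H$). Let $B_k:\mathbb R^k\to\mathcal H$, $B_k x=\sum_{i\le k}x_ib_i$, with QR decomposition $B_k=Q_k\mathbf R_k$, where $Q_kx=\sum_{i\le k}x_ie_i$ and $\mathbf R_k$ is an invertible upper-triangular $k\times k$ matrix. $\mathbb P_K$ is a probability distribution on $\mathbb N$ with infinite support; for $K\sim\mathbb P_K$ put $t_i=\mathbb P[K\ge i]>0$ and $\mathbf T_k=\mathrm{diag}(t_1,\dots,t_k)$. For $k\in\mathbb N$, $\mathbb P_{v\mid k}$ is the law of $v=B_k\mathbf R_k^{-1}\mathbf T_k^{-1/2}\mathbf z$ with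 $\mathbf z\sim\mathcal N(0,\mathbf I_k)$. Algorithm parameters: a positive bounded real sequence $\{\lambda_k\}_{k\in\mathbb N}$, sample sizes $M_k\in\mathbb N$, learning rates $\alpha_n>0$. Put $\gamma_i=\mathbb E[\lambda_K\mid K\ge i]$ and let $C:\mathcal H\to\mathcal H$ be the diagonal operator $Ch=\sum_i\gamma_i\langle e_i,h\rangle e_i$; powers are $C^sh=\sum_i\gamma_i^s\langle e_i,h\rangle e_i$ (possibly unbounded, on their natural domains). $C^{1/2}(\mathcal H)$ is the range of $C^{1/2}$, and for $h\in C^{1/2}(\mathcal H)$, $\|h\|_C^2=\|C^{-1/2}h\|^2=\sum_i\langle h,e_i\rangle^2/\gamma_i$. FGFD algorithm: start from a (deterministic) $h_1\in C^{1/2}(\mathcal H)$. At iteration $n$, independently of the past, sample $K_n\sim\mathbb P_K$; given $K_n=k$, sample $v_1,\dots,v_{M_k}$ i.i.d. from $\mathbb P_{v\mid k}$; set $\hat g_n=\frac{\lambda_k}{M_k}\sum_{m=1}^{M_k}D\mathcal R(h_n;v_m)\,v_m$ and $h_{n+1}=h_n-\alpha_n\hat g_n$. $\mathbb E_n$ denotes conditional expectation given $h_1,\dots,h_n$. *)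

(* Defs.v *)
From HB Require Import structures.
From mathcomp Require Import all_boot all_order all_algebra.
From mathcomp Require Import all_classical all_reals all_analysis.
From mathcomp Require Import measurable_realfun.

Set Implicit Arguments.
Unset Strict Implicit.
Unset Printing Implicit Defensive.

Import Order.TTheory GRing.Theory Num.Theory.
Import numFieldNormedType.Exports.

Local Open Scope classical_set_scope.
Local Open Scope ring_scope.

(* Indexing: the sequences of vectors b_1, b_2, ... and e_1, e_2, ... and the
   iterations 1, 2, ... of the algorithm are numbered from 0 here, so b i is
   b_{i+1}.  The values k of K, and the indices of t, gamma, lambda and M, are
   the actual ones; the value 0 has probability 0, and the coefficient of C
   along e i is gamma i.+1. *)

Section Hilbert.
Context {R : realType} {H : completeNormedModType R}.
Implicit Types (dot : H -> H -> R) (b e : nat -> H).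

(* dot is an inner product inducing the norm of H; together with completeness
   this makes H a real Hilbert space. *)
Record is_inner_product dot : Prop := IsInnerProduct {
  dot_sym : forall x y, dot x y = dot y x;
  dot_linear : forall a x y z, dot (a *: x + y) z = a * dot x z + dot y z;
  dot_norm : forall x, dot x x = `|x| ^+ 2 }.

(* b is linearly independent, hence injective, with dense span.  The existence
   of such a sequence makes H separable and infinite-dimensional. *)
Record is_prebasis b : Prop := IsPrebasis {
  prebasis_free : forall n (a : 'I_n -> R),
    \sum_(i < n) a i *: b i = 0 -> forall i, a i = 0;
  prebasis_dense :
    dense [set x : H | exists n (a : 'I_n -> R), x = \sum_(i < n) a i *: b i] }.

Fixpoint gs_seq dot b (n : nat) : seq H :=
  if n is n'.+1 then
    let s := gs_seq dot b n' in
    let u := b n' - \sum_(x <- s) dot x (b n') *: x in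
    rcons s (`|u|^-1 *: u)
  else [::].

Definition gram_schmidt dot b (i : nat) : H := nth 0 (gs_seq dot b i.+1) i.

(* B_k is synth b k and Q_k is synth (gram_schmidt dot b) k. *)
Definition synth b (k : nat) (x : 'cV[R]_k) : H := \sum_(i < k) x i 0 *: b i.

Definition is_QR dot b (k : nat) (Rk : 'M[R]_k) : Prop :=
  [/\ Rk \in unitmx,
      forall i j : 'I_k, (j < i)%N -> Rk i j = 0
    & forall x, synth b x = synth (gram_schmidt dot b) (Rk *m x)].

Definition is_gradient dot (Rf : H -> R) (grad : H -> H) : Prop :=
  forall h, differentiable Rf h /\ forall v, 'd Rf h v = dot (grad h) v.

Definition borel_H : set (set H) := <<s @open H >>.

End Hilbert.

Section Gaussian.
Context {R : realType}.

Local Notation T := (measurableTypeR R).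

Definition tcons k (p : T * k.-tuple T) : k.+1.-tuple T := cons_tuple p.1 p.2.

Lemma measurable_tcons k : measurable_fun setT (@tcons k).
Proof. exact: measurable_cons. Qed.

HB.instance Definition _ k :=
  isMeasurableFun.Build _ _ _ _ (@tcons k) (@measurable_tcons k).

(* N(0, I_k), built as the k-fold product of N(0, 1). *)
Fixpoint std_gaussian (k : nat) : probability (k.-tuple T) R :=
  match k with
  | 0 => \d_([tuple] : 0.-tuple T)
  | k'.+1 => distribution
      (normal_prob 0 1 \x std_gaussian k')%E
      (@tcons k')
  end.

End Gaussian.

Section Covariance.
Context {R : realType} {H : completeNormedModType R}.
Variable PK : probability nat R.
Implicit Types (dot : H -> H -> R) (b e : nat -> H) (lam gam : nat -> R).

(* PK lives on {1, 2, ...} and has infinite support. *)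
Definition infinite_support_pos : Prop :=
  PK [set 0%N] = 0%E /\ infinite_set [set k | PK [set k] != 0%E].

Definition tail (i : nat) : R := fine (PK [set k | (i <= k)%N]).

(* gamma_i = E[lambda_K | K >= i] *)
Definition gamma lam (i : nat) : R :=
  (\int[PK]_(k in [set k | (i <= k)%N]) lam k) / tail i.

(* The law P_{v|k}, as a function of Borel sets of H. *)
Definition dir_law b (Rm : forall k, 'M[R]_k) (k : nat) (B : set H) : \bar R :=
  let T := diag_mx (\row_(i < k) (Num.sqrt (tail i.+1))^-1) in
  std_gaussian k [set z |
    B (synth b (invmx (Rm k) *m (T *m \col_i tnth z i)))].

(* Cpow e gam s x y: x is in the natural domain of C^s and C^s x = y. *)
Definition Cpow e dot gam (s : R) (x y : H) : Prop :=
  (fun n => \sum_(i < n) (gam i.+1 `^ s * dot (e i) x) *: e i) @ \oo --> y.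

Definition C12_range e dot gam : set H :=
  [set y | exists x, Cpow e dot gam 2^-1 x y].

(* ||h||_C^2, equal to +oo when h is not in C^{1/2}(H). *)
Definition normC2 e dot gam (h : H) : \bar R :=
  (\sum_(0 <= i <oo) (dot h (e i) ^+ 2 / gam i.+1)%:E)%E.

End Covariance.

Section Algorithm.
Context {R : realType} {H : completeNormedModType R}.
Context {d : measure_display} {Omega : measurableType d}.
Variable P : probability Omega R.
Variables (Rf : H -> R) (lam : nat -> R) (M : nat -> nat) (alpha : nat -> R).
Variable h1 : H.
(* K n is the level drawn at iteration n; its directions are the v n m with
   m < M (K n), and the other v n m play no role. *)
Variables (K : nat -> Omega -> nat) (v : nat -> nat -> Omega -> H).

Definition fgfd_grad (h : H) (k : nat) (w : nat -> H) : H :=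
  (lam k / (M k)%:R) *: \sum_(m < M k) 'D_(w m) Rf h *: w m.

Fixpoint fgfd_iter (n : nat) (x : Omega) : H :=
  if n is n'.+1 then
    fgfd_iter n' x
      - alpha n' *: fgfd_grad (fgfd_iter n' x) (K n' x) (fun m => v n' m x)
  else h1.

Definition fgfd_ghat (n : nat) (x : Omega) : H :=
  fgfd_grad (fgfd_iter n x) (K n x) (fun m => v n m x).

(* The sigma-algebra of everything drawn before iteration n. *)
Definition past (n : nat) : set (set Omega) :=
  <<s [set A | exists j k, (j < n)%N /\
        (A = K j @^-1` [set k] \/
         exists m B, [/\ (m < M k)%N, borel_H B
                       & A = K j @^-1` [set k] `&` v j m @^-1` B])] >>.

(* Independently of the past, K n has law PK and, given K n = k, the
   v n m (m < M k) are i.i.d. with law nu k. *)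
Record fgfd_sampling (PK : probability nat R) (nu : nat -> set H -> \bar R) :
    Prop := FGFDSampling {
  fgfd_measurable_K : forall n, measurable_fun setT (K n);
  fgfd_measurable_v : forall n m B, borel_H B -> measurable (v n m @^-1` B);
  fgfd_law : forall n A k (B : nat -> set H),
    past n A -> (forall m, borel_H (B m)) ->
    P (A `&` K n @^-1` [set k] `&` \bigcap_(m < M k) (v n m @^-1` B m)) =
    (P A * PK [set k] * \prod_(m < M k) nu k (B m))%E }.

(* The sigma-algebra generated by the first n.+1 iterates. *)
Definition sigma_iter (n : nat) : set (set Omega) :=
  <<s [set A | exists j B, [/\ (j <= n)%N, borel_H B
                            & A = fgfd_iter j @^-1` B]] >>.

End Algorithm.

(* Y is a version of the conditional expectation of the nonnegative X given
   the sigma-algebra G. *)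
Record is_cond_exp {R : realType} {d : measure_display} {T : measurableType d}
    (P : probability T R) (G : set (set T)) (X Y : T -> \bar R) : Prop :=
  IsCondExp {
    cond_exp_ge0 : forall x, (0 <= Y x)%E;
    cond_exp_measurable : forall B : set (\bar R), measurable B -> G (Y @^-1` B);
    cond_exp_int : forall A, G A ->
      (\int[P]_(x in A) Y x = \int[P]_(x in A) X x)%E }.

(* Main.v *)
From HB Require Import structures.
Require Import Defs.
From mathcomp Require Import all_boot all_order all_algebra finmap.
From mathcomp Require Import all_classical all_reals all_analysis.
From mathcomp Require Import measurable_realfun ring lra.

Set Implicit Arguments.
Unset Strict Implicit.
Unset Printing Implicit Defensive.

Import Order.TTheory GRing.Theory Num.Theory.
Import numFieldNormedType.Exports.

Local Open Scope classical_set_scope.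
Local Open Scope ring_scope.

(** Fix an iteration and a level k, and write g for the gradient, g_i for its
    coordinates in the Gram-Schmidt basis (e_i), t_i = P(K >= i) and
    S_k = sum_(i <= k) g_i^2 / t_i.  Vectors are numbered from 1 here and from 0
    in the code, where e i goes with t i.+1.

    Given K = k, the factor R_k^-1 cancels the triangular factor of B_k, so a
    direction is v = sum_(i <= k) t_i^(-1/2) z_i e_i with independent standard
    normal z_i ([synth_invR], [dir_law_box], [dir_law_orth]).  The coordinate of
    the estimate along e_i is therefore lambda_k / M_k times the sum over m of
    sum_j (t_j t_i)^(-1/2) g_j z_mj z_mi.  Its second moment involves products
    of four normal variables; a product with an isolated factor has mean 0,
    and what remains is at most
    (lambda_k / M_k)^2 t_i^-1 (M_k S_k + (M_k^2 + M_k) g_i^2 / t_i)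
    ([moment_hits_off], [moment_hits_le]).

    The squared norm weighs this with 1 / gamma_i.  For lambda = t the numbers
    p_k t_k = (t_k - t_(k+1)) t_k dominate (t_k^2 - t_(k+1)^2) / 2, and a
    telescoping sum gives gamma_i >= t_i / 2 ([gamma_tail_ge]).  With
    lambda_k = t_k <= t_i and k <= c M_k, the sum over i <= k of the weighted
    second moments is at most 2 (k / M_k + 1 + 1 / M_k) S_k <= 2 (1 + 2 c) S_k
    ([level_bound]).  Averaging over K restores the norm of the gradient:
    sum_k P(K = k) S_k = sum_i g_i^2 / t_i P(K >= i) = |g|^2 ([sum_tail]).

    Conditioning is expressed by integrals over the events A of the past.  The
    gradient is a function of the past, and the normal variables drawn on the
    level k are independent of it, so that the expectations of products
    factorize ([integral_prod_indep], [integral_level]).  The cross terms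
    g_j g_j' are signed, hence A is first restricted to events on which the
    gradient is bounded; these exhaust the space, which is enough for an almost
    sure bound on a conditional expectation ([cond_exp_le]).  That the iterates
    are functions of the past rests on the separability of H: Borel sets are
    determined by countably many coordinates ([coord_borel]). *)

(** * Expansions in the Gram-Schmidt basis *)

Section InnerProduct.
Context {R : realType} {H : completeNormedModType R}.
Variables (dot : H -> H -> R) (dotP : is_inner_product dot).

Let dotC x y : dot x y = dot y x. Proof. exact: dot_sym. Qed.

Lemma dotDl x y z : dot (x + y) z = dot x z + dot y z.
Proof. by have := dot_linear dotP 1 x y z; rewrite scale1r mul1r. Qed.

Lemma dot0l z : dot 0 z = 0.
Proof. by have := dotDl 0 0 z; rewrite addr0; lra. Qed.

Lemma dotZl a x z : dot (a *: x) z = a * dot x z.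
Proof. by have := dot_linear dotP a x 0 z; rewrite addr0 dot0l addr0. Qed.

Lemma dotNl x z : dot (- x) z = - dot x z.
Proof. by rewrite -scaleN1r dotZl mulN1r. Qed.

Lemma dotBl x y z : dot (x - y) z = dot x z - dot y z.
Proof. by rewrite dotDl dotNl. Qed.

Lemma dotZr a x z : dot x (a *: z) = a * dot x z.
Proof. by rewrite ![dot x _]dotC dotZl. Qed.

Lemma dot0r x : dot x 0 = 0.
Proof. by rewrite dotC dot0l. Qed.

Lemma dotBr x y z : dot x (y - z) = dot x y - dot x z.
Proof. by rewrite ![dot x _]dotC dotBl. Qed.

Lemma dot_suml (I : Type) (r : seq I) (Q : pred I) (F : I -> H) z :
  dot (\sum_(i <- r | Q i) F i) z = \sum_(i <- r | Q i) dot (F i) z.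
Proof.
by apply: (big_morph (fun x => dot x z)) => [x y|]; rewrite ?dotDl ?dot0l.
Qed.

Lemma dot_sumr (I : Type) (r : seq I) (Q : pred I) (F : I -> H) z :
  dot z (\sum_(i <- r | Q i) F i) = \sum_(i <- r | Q i) dot z (F i).
Proof. by rewrite dotC dot_suml; apply: eq_bigr => i _; rewrite dotC. Qed.

Lemma normsqB x y : `|x - y| ^+ 2 = `|x| ^+ 2 - dot x y *+ 2 + `|y| ^+ 2.
Proof.
by rewrite -!(dot_norm dotP) dotBl !dotBr (dotC y x); ring.
Qed.

Lemma cauchy_schwarz x y : `|dot x y| <= `|x| * `|y|.
Proof.
have [->|y0] := eqVneq y 0; first by rewrite dot0r !normr0 mulr0.
have ny : 0 < `|y| by rewrite normr_gt0.
have := sqr_ge0 `|x - (dot x y / `|y| ^+ 2) *: y|.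
rewrite normsqB dotZr normrZ exprMn real_normK ?num_real// => h.
rewrite -ler_sqr ?nnegrE ?mulr_ge0// exprMn real_normK ?num_real//.
rewrite -ler_pdivrMr ?exprn_gt0//.
move: h; set a := dot x y; set s := `|y| in ny *.
have -> : `|x| ^+ 2 - (a / s ^+ 2 * a) *+ 2 + (a / s ^+ 2) ^+ 2 * s ^+ 2 =
          `|x| ^+ 2 - a ^+ 2 / s ^+ 2 by field; rewrite gt_eqF.
by rewrite subr_ge0.
Qed.

Lemma continuous_dotl y : continuous (fun x => dot x y).
Proof.
move=> x; apply/cvgrPdist_lt => eps eps0; near=> z.
rewrite -dotBl (le_lt_trans (cauchy_schwarz _ _))//.
apply: (@le_lt_trans _ _ (`|x - z| * (1 + `|y|))).
  by rewrite ler_wpM2l// lerDr.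
rewrite -ltr_pdivlMr ?ltr_wpDr//.
near: z; apply: cvgr_dist_lt => //.
  by rewrite divr_gt0// ltr_wpDr.
Unshelve. all: by end_near. Qed.

Definition orthonormal_seq (e : nat -> H) :=
  forall i j, dot (e i) (e j) = (i == j)%:R.

Section Orthonormal.
Variables (e : nat -> H) (eP : orthonormal_seq e).

Lemma dot_sum_orthonormal n (a : 'I_n -> R) (j : 'I_n) :
  dot (\sum_(i < n) a i *: e i) (e j) = a j.
Proof.
rewrite dot_suml (bigD1 j)//= big1 ?addr0 => [|i ij].
  by rewrite dotZl eP eqxx mulr1.
by rewrite dotZl eP (negbTE ij : (i == j :> nat) = false) mulr0.
Qed.

Lemma dot_sum_orthonormal0 n (a : 'I_n -> R) (j : nat) : (n <= j)%N ->
  dot (\sum_(i < n) a i *: e i) (e j) = 0.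
Proof.
move=> nj; rewrite dot_suml big1// => i _.
by rewrite dotZl eP ltn_eqF ?mulr0// (leq_trans _ nj).
Qed.

(** Completing the square.  Among the combinations of e_0, ..., e_(n-1) the
    closest to x is thus the one with the coefficients <x, e_i>. *)
Lemma normsq_sub_sum n x (a : 'I_n -> R) :
  `|x - \sum_(i < n) a i *: e i| ^+ 2 =
  `|x| ^+ 2 - \sum_(i < n) dot x (e i) ^+ 2 +
  \sum_(i < n) (a i - dot x (e i)) ^+ 2.
Proof.
rewrite normsqB -[X in _ + X](dot_norm dotP) !dot_sumr.
under [X in _ + X]eq_bigr do rewrite dotZr dot_sum_orthonormal.
rewrite -sumrMnl -addrA -sumrN -addrA -sumrN -!big_split/=; congr (_ + _).
by apply: eq_bigr => i _; rewrite dotZr; ring.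
Qed.

Lemma normsq_sub_proj n x :
  `|x - \sum_(i < n) dot x (e i) *: e i| ^+ 2 =
  `|x| ^+ 2 - \sum_(i < n) dot x (e i) ^+ 2.
Proof.
rewrite normsq_sub_sum [X in _ + X]big1 ?addr0// => i _.
by rewrite subrr expr0n.
Qed.

Definition dense_span := dense [set x : H | exists n (a : 'I_n -> R),
  x = \sum_(i < n) a i *: e i].

Hypothesis e_dense : dense_span.

(** A point of the span close to x involves finitely many e_i, and a partial
    sum of the expansion of x that contains their indices is at least as close
    to x. *)
Lemma cvg_proj x : (fun n => \sum_(i < n) dot x (e i) *: e i) @ \oo --> x.
Proof.
apply/cvgrPdist_lt => eps eps0.
have [//||y [xy [N [a ya]]]] := e_dense (O := ball x eps).
- by exists x; exact: ballxx.
- exact: ball_open.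
move: xy; rewrite -ball_normE /= => xy.
exists N => // n /= Nn; apply: le_lt_trans xy.
rewrite ya -ler_sqr ?nnegrE// normsq_sub_proj normsq_sub_sum.
apply: (@le_trans _ _ (`|x| ^+ 2 - \sum_(i < N) dot x (e i) ^+ 2)); last first.
  by rewrite lerDl sumr_ge0// => i _; exact: sqr_ge0.
rewrite lerD2l lerN2 -!(big_mkord xpredT (fun i => dot x (e i) ^+ 2)).
rewrite [leRHS](big_cat_nat (n := N))//= lerDl sumr_ge0// => i _.
exact: sqr_ge0.
Qed.

Lemma cvg_dot_proj x y :
  (fun n => \sum_(i < n) dot x (e i) * dot y (e i)) @ \oo --> dot x y.
Proof.
have := cvg_comp _ _ (@cvg_proj x) (@continuous_dotl y x).
apply: cvg_trans; apply: near_eq_cvg; apply: nearW => n /=.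
by rewrite dot_suml; apply: eq_bigr => i _; rewrite dotZl (dotC y).
Qed.

Lemma cvg_parseval x :
  (fun n => \sum_(i < n) dot x (e i) ^+ 2) @ \oo --> `|x| ^+ 2.
Proof.
rewrite -(dot_norm dotP); have := @cvg_dot_proj x x.
apply: cvg_trans; apply: near_eq_cvg; apply: nearW => n /=.
by apply: eq_bigr => i _; rewrite expr2.
Qed.

Lemma sum_proj_eq k v : (forall l, (k <= l)%N -> dot v (e l) = 0) ->
  v = \sum_(i < k) dot v (e i) *: e i.
Proof.
move=> v0; rewrite -[LHS](cvg_lim (@norm_hausdorff _ _) (@cvg_proj v)).
apply: cvg_lim; first exact: norm_hausdorff.
apply: cvg_near_cst; exists k => // n /= kn.
rewrite -!(big_mkord xpredT (fun i => dot v (e i) *: e i)).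
rewrite [LHS](big_cat_nat (n := k))//= [X in _ + X]big_nat_cond.
rewrite [X in _ + X]big1 ?addr0//.
by move=> i; rewrite andbT => /andP[ki _]; rewrite v0// scale0r.
Qed.

End Orthonormal.
End InnerProduct.

Section GramSchmidt.
Context {R : realType} {H : completeNormedModType R}.
Variables (dot : H -> H -> R) (dotP : is_inner_product dot).
Variables (b : nat -> H) (bP : is_prebasis b).
Variables (Rm : forall k, 'M[R]_k) (RmP : forall k, is_QR dot b (Rm k)).
Local Notation e := (gram_schmidt dot b).

Lemma gs_seqE n : gs_seq dot b n = mkseq e n.
Proof.
elim: n => [//|n IH]; rewrite mkseqS -IH /= /gram_schmidt/=.
by congr rcons; rewrite nth_rcons IH size_mkseq ltnn eqxx.
Qed.

Lemma gram_schmidtE n :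
  let u := b n - \sum_(i < n) dot (e i) (b n) *: e i in e n = `|u|^-1 *: u.
Proof.
move=> u; rewrite [LHS]/gram_schmidt/= nth_rcons gs_seqE size_mkseq ltnn eqxx.
have -> : mkseq e n = map e (index_iota 0 n) by rewrite /index_iota subn0.
by rewrite big_map big_mkord.
Qed.

(** The change of basis behind the law of the directions: the triangular factor
    disappears, and the entries of y become coordinates in an orthonormal
    basis. *)
Lemma synth_invR k (y : 'cV[R]_k) :
  synth b (invmx (Rm k) *m y) = synth e y.
Proof. by case: (RmP k) => u _ ->; rewrite mulKVmx. Qed.

(** By the QR factorization the subtracted projection is a combination of
    b_0, ..., b_(n-1), so that a vanishing residual would contradict linear
    independence. *)
Lemma gram_schmidt_res_neq0 n :
  b n - \sum_(i < n) dot (e i) (b n) *: e i != 0.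
Proof.
pose y : 'cV[R]_n := \col_i dot (e i) (b n).
have -> : \sum_(i < n) dot (e i) (b n) *: e i = synth e y.
  by apply: eq_bigr => i _; rewrite mxE.
rewrite -synth_invR; set x := invmx _ *m _; apply/eqP => bx0.
(* the coefficients of b_n - sum_i x_i b_i *)
pose a (i : 'I_n.+1) : R := if unlift ord_max i is Some j then - x j 0 else 1.
have /(prebasis_free bP)/(_ ord_max) : \sum_(i < n.+1) a i *: b i = 0.
  rewrite big_ord_recr/= /a unlift_none scale1r addrC; apply: etrans bx0.
  congr (_ + _).
  rewrite /synth -sumrN; apply: eq_bigr => i _.
  have -> : widen_ord (leqnSn n) i = lift ord_max i.
    by apply: val_inj; rewrite /= /bump leqNgt ltn_ord.
  by rewrite liftK scaleNr.
by rewrite /a unlift_none => /eqP; rewrite oner_eq0.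
Qed.

Lemma gram_schmidt_orthonormal : orthonormal_seq dot e.
Proof.
suff main n i j : (i < n)%N -> (j < n)%N -> dot (e i) (e j) = (i == j)%:R.
  by move=> i j; apply: (main (maxn i j).+1); rewrite ltnS ?leq_maxl ?leq_maxr.
elim: n i j => // n IH.
set u := b n - \sum_(i < n) dot (e i) (b n) *: e i.
have u0 : 0 < `|u| by rewrite normr_gt0 gram_schmidt_res_neq0.
have enu : e n = `|u|^-1 *: u by rewrite gram_schmidtE.
have orth i : (i < n)%N -> dot (e i) (e n) = 0.
  move=> iin; rewrite enu dotZr// dotBr// dot_sumr// (bigD1 (Ordinal iin))//=.
  rewrite big1 ?addr0 => [|j ji]; last first.
    rewrite dotZr// IH// eq_sym.
    by rewrite (negbTE ji : (j == i :> nat) = false) mulr0.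
  by rewrite dotZr// IH// eqxx mulr1 subrr mulr0.
move=> i j; rewrite ltnS leq_eqVlt => /predU1P[->|iin];
  rewrite ltnS leq_eqVlt => /predU1P[->|jn].
- rewrite eqxx enu dotZl// dotZr// (dot_norm dotP).
  by rewrite expr2 mulKf ?gt_eqF// mulVf ?gt_eqF.
- by rewrite (dot_sym dotP) orth// gtn_eqF.
- by rewrite orth// ltn_eqF.
- exact: IH.
Qed.

(** The QR factorization turns every combination of the b_i into one of the
    e_i. *)
Lemma gram_schmidt_dense : dense_span e.
Proof.
move=> O O0 Oo; have [x [Ox [n [a xa]]]] := prebasis_dense bP O0 Oo.
exists x; split=> //; exists n.
exists (fun i => (Rm n *m \col_i a i) i 0).
have [_ _ /(_ (\col_i a i))] := RmP n; rewrite /synth => <-.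
by rewrite xa; apply: eq_bigr => i _; rewrite mxE.
Qed.

End GramSchmidt.

(** * Borel functions into a separable Hilbert space *)

Section Borel.
Context {R : realType} {H : completeNormedModType R}.
Variables (dot : H -> H -> R) (dotP : is_inner_product dot).
Variables (e : nat -> H) (eP : orthonormal_seq dot e) (e_dense : dense_span e).
Context {d : measure_display} {T : measurableType d}.
Implicit Types (f : T -> H).

Definition borel_measurable f := forall B, borel_H B -> measurable (f @^-1` B).

(** The vector operations preserve this form of measurability by the theory of
    real functions; by [coord_borel] it implies Borel measurability. *)
Definition coord_measurable f :=
  forall i, measurable_fun setT (fun x => dot (f x) (e i)).

Lemma borel_measurable_open f :
  (forall U, open U -> measurable (f @^-1` U)) -> borel_measurable f.
Proof.
move=> fo B; rewrite -[f @^-1` B]setTI.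
apply: (@smallest_sub _ (sigma_algebra setT) open
  (image_set_system setT f measurable)).
  by apply: sigma_algebra_image; exact: sigma_algebra_measurable.
by move=> U oU; rewrite /image_set_system/= setTI; exact: fo.
Qed.

Lemma measurable_continuous_comp f (phi : H -> R) :
  borel_measurable f -> continuous phi -> measurable_fun setT (phi \o f).
Proof.
move=> bf cphi; apply: (measurability _ (RGenOpens.measurableE R)).
move=> _ [_ [a [b ->]] <-]; rewrite setTI comp_preimage; apply: bf.
apply: sub_sigma_algebra; apply: open_comp; last exact: interval_open.
by move=> x _; exact: cphi.
Qed.

Lemma borel_coord f : borel_measurable f -> coord_measurable f.
Proof.
move=> bf i.
apply: (@measurable_continuous_comp f (fun h => dot h (e i))) => //.
exact: continuous_dotl.
Qed.

(** By the Parseval identity the inner product is a limit of finite sums of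
    products of coordinates. *)
Lemma measurable_dot f g : coord_measurable f -> coord_measurable g ->
  measurable_fun setT (fun x => dot (f x) (g x)).
Proof.
move=> mf mg; apply: measurable_fun_cvg => [|x _]; last first.
  exact: (cvg_dot_proj dotP eP e_dense).
move=> n /=; apply: measurable_sum => i; exact: measurable_funM.
Qed.

Lemma measurable_normsq f : coord_measurable f ->
  measurable_fun setT (fun x => `|f x| ^+ 2).
Proof.
move=> mf; under eq_fun do rewrite -(dot_norm dotP); exact: measurable_dot.
Qed.

Lemma coord_measurableD f g : coord_measurable f -> coord_measurable g ->
  coord_measurable (fun x => f x + g x).
Proof.
move=> mf mg i; under eq_fun do rewrite (dotDl dotP).
exact: measurable_funD.
Qed.

Lemma coord_measurableZ (a : T -> R) f :
  measurable_fun setT a -> coord_measurable f ->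
  coord_measurable (fun x => a x *: f x).
Proof.
move=> ma mf i; under eq_fun do rewrite (dotZl dotP).
exact: measurable_funM.
Qed.

Lemma coord_measurable_cst y : coord_measurable (fun _ => y).
Proof. by move=> i; exact: measurable_cst. Qed.

Lemma coord_measurableB f g : coord_measurable f -> coord_measurable g ->
  coord_measurable (fun x => f x - g x).
Proof.
move=> mf mg i; under eq_fun do rewrite (dotBl dotP).
exact: measurable_funB.
Qed.

Lemma coord_measurable_sum n (f : 'I_n -> T -> H) :
  (forall i, coord_measurable (f i)) ->
  coord_measurable (fun x => \sum_(i < n) f i x).
Proof.
move=> mf j; under eq_fun do rewrite (dot_suml dotP).
by apply: measurable_sum => i; exact: mf.
Qed.

Let rat_point (q : seq rat) : H := \sum_(i < size q) ratr (nth 0 q i) *: e i.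

Let rat_point_dense x (r : R) : 0 < r -> exists q, `|x - rat_point q| < r.
Proof.
move=> r0; have /cvgrPdist_lt/(_ (r / 2)) := cvg_proj dotP eP e_dense (x := x).
rewrite divr_gt0// => /(_ isT)[n _ /(_ n (leqnn n))/= xn].
have eps0 : 0 < r / 2 / n.+1%:R by rewrite !divr_gt0.
have /choice[c cP] i : exists q : rat,
    `|dot x (e i) - ratr q| < r / 2 / n.+1%:R.
  have [|q] := @rat_in_itvoo R (dot x (e i)) (dot x (e i) + r / 2 / n.+1%:R).
    by rewrite ltrDl.
  rewrite in_itv/= => /andP[q1 q2]; exists q; rewrite distrC gtr0_norm.
    by rewrite ltrBlDl.
  by rewrite subr_gt0.
(* half of r is spent on truncating the expansion, the other half is shared
   among the n coefficients *)
exists (mkseq c n); rewrite /rat_point size_mkseq.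
rewrite -(subrKA (\sum_(i < n) dot x (e i) *: e i)).
rewrite (le_lt_trans (ler_normD _ _))// [ltRHS](splitr r) ltr_leD// -sumrB.
apply: le_trans (ler_norm_sum _ _ _) _.
apply: (@le_trans _ _ (\sum_(i < n) (r / 2 / n.+1%:R))).
  apply: ler_sum => i _; rewrite nth_mkseq// -scalerBl normrZ.
  have -> : `|e i| = 1.
    apply/eqP; rewrite -(@eqrXn2 _ 2)// -(dot_norm dotP) eP eqxx.
    by rewrite expr1n.
  by rewrite mulr1 ltW.
rewrite sumr_const card_ord -[leLHS]mulr_natr -[leLHS]mulrA.
rewrite ler_piMr ?divr_ge0 ?(ltW r0)//.
by rewrite mulrC ler_pdivrMr// mul1r ler_nat.
Qed.

(** By separability an open set is a countable union of balls centred at the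
    points [rat_point], and the distance to a centre is a function of the
    coordinates. *)
Lemma coord_borel f : coord_measurable f -> borel_measurable f.
Proof.
move=> mf; apply: borel_measurable_open => U oU.
pose D (q : seq rat * nat) : set H :=
  if `[< ball (rat_point q.1) q.2.+1%:R^-1 `<=` U >] then
  ball (rat_point q.1) q.2.+1%:R^-1 else set0.
have -> : U = \bigcup_q D q.
  apply/seteqP; split=> [x Ux|x [q _]]; last first.
    by rewrite /D; case: asboolP => // + xq; exact.
  have /nbhs_ballP[r /= r0 rU] := open_nbhs_nbhs (conj oU Ux).
  have r20 : 0 < r / 2 by rewrite divr_gt0.
  have [n _ /(_ n (leqnn n))/= nr] := near_infty_natSinv_lt (PosNum r20).
  have [|q xq] := @rat_point_dense x n.+1%:R^-1; first by rewrite invr_gt0.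
  exists (q, n) => //; rewrite /D/=; case: asboolP => [_|[]].
    by rewrite -ball_normE/= distrC.
  move=> y; rewrite -ball_normE/= => qy; apply: rU; rewrite -ball_normE/=.
  rewrite -(subrKA (rat_point q)) (le_lt_trans (ler_normD _ _))//.
  by rewrite [ltRHS](splitr r) ltrD// (lt_trans _ nr).
rewrite preimage_bigcup; apply: countable_bigcupT_measurable => //.
move=> q; rewrite /D; case: asboolP => _; last by rewrite preimage_set0.
rewrite -ball_normE.
have -> : f @^-1` [set y | `|rat_point q.1 - y| < q.2.+1%:R^-1] =
  (fun x => `|rat_point q.1 - f x| ^+ 2 < q.2.+1%:R^-1 ^+ 2) @^-1` [set true].
  apply/seteqP; split=> x /=.
    by rewrite ltr_sqr ?nnegrE.
  by rewrite ltr_sqr ?nnegrE.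
rewrite -[X in measurable X]setTI.
apply: measurable_fun_ltr => //; apply: measurable_normsq.
by apply: coord_measurableB => //; exact: coord_measurable_cst.
Qed.

End Borel.

(** * Measurability of the gradient *)

Section Gradient.
Context {R : realType} {H : completeNormedModType R}.
Variables (dot : H -> H -> R) (dotP : is_inner_product dot).
Variables (e : nat -> H) (eP : orthonormal_seq dot e) (e_dense : dense_span e).
Variables (Rf : H -> R) (grad : H -> H) (gradP : is_gradient dot Rf grad).
Context {d : measure_display} {T : measurableType d}.

Lemma derive_grad h v : 'D_v Rf h = dot (grad h) v.
Proof. by have [dR <-] := gradP h; rewrite deriveE. Qed.

Lemma cvg_grad h v :
  (fun n => n.+1%:R * (Rf (n.+1%:R^-1 *: v + h) - Rf h)) @ \oo
    --> dot (grad h) v.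
Proof.
have /(@diff_derivable _ _ _ _ _ v) dv := (gradP h).1.
have cv : (n.+1%:R^-1 : R) @[n --> \oo] --> 0^'.
  move=> A [r /= r0 rA]; have := near_infty_natSinv_lt (PosNum r0).
  apply: filterS => n /= nr; apply: rA => /=; last by rewrite invr_neq0.
  by rewrite sub0r normrN gtr0_norm// invr_gt0.
have := cvg_comp _ _ cv dv; rewrite -/('D_v Rf h) derive_grad.
apply: cvg_trans; apply: near_eq_cvg; apply: nearW => n /=.
by rewrite invrK.
Qed.

(** The gradient may be discontinuous, but its coordinates are limits of
    difference quotients of the continuous function Rf. *)
Lemma coord_measurable_grad (f : T -> H) : coord_measurable dot e f ->
  coord_measurable dot e (grad \o f).
Proof.
move=> mf i; apply: (@measurable_fun_cvg _ _ _ _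
  (fun n x => n.+1%:R * (Rf (n.+1%:R^-1 *: e i + f x) - Rf (f x)))).
  move=> n; apply: measurable_funM => //.
  have cR : continuous Rf.
    by move=> h; apply: differentiable_continuous; case: (gradP h).
  apply: measurable_funB.
    apply: (@measurable_continuous_comp _ _ _ _
      (fun x => n.+1%:R^-1 *: e i + f x) Rf) => //.
    apply: (coord_borel dotP eP e_dense); apply: coord_measurableD => //.
  apply: (@measurable_continuous_comp _ _ _ _ f Rf) => //.
  exact: (coord_borel dotP eP e_dense).
by move=> x _; exact: cvg_grad.
Qed.

End Gradient.

Section SubSigma.
Context {R : realType} {H : completeNormedModType R}.
Context {d : measure_display} {T : measurableType d}.
Variable G : set (set T).
Hypothesis GT : G `<=` measurable.

Lemma sub_sigma_measurable : <<s G >> `<=` measurable.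
Proof. by apply: smallest_sub => //; exact: sigma_algebra_measurable. Qed.

Lemma sub_sigma_measurable_fun d' (T' : measurableType d') (f : T -> T') :
  measurable_fun (setT : set (g_sigma_algebraType G)) f ->
  measurable_fun (setT : set T) f.
Proof.
by move=> mf _ B mB; apply: sub_sigma_measurable; exact: (mf measurableT).
Qed.

End SubSigma.

(** * Integrals determined by their values on indicators *)

Section Extension.
Context {R : realType} {d d' : measure_display}.
Context {T : measurableType d} {T' : measurableType d'}.
Variables (mu : {measure set T -> \bar R}) (nu : {measure set T' -> \bar R}).
Variables (D : set T) (mD : measurable D) (W : T -> R) (Z : T -> T') (c : R).
Hypotheses (W0 : forall x, 0 <= W x) (mW : measurable_fun D W).
Hypotheses (mZ : measurable_fun setT Z).
Hypothesis WZ : forall B, measurable B ->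
  (\int[mu]_(x in D) (W x * \1_B (Z x))%:E = c%:E * nu B)%E.

Import HBNNSimple.

Let ext_nnsfun (h : {nnsfun T' >-> R}) :
  (\int[mu]_(x in D) (W x * h (Z x))%:E = c%:E * \int[nu]_y (h y)%:E)%E.
Proof.
pose s := fset_set (range h).
have s0 (i : 'I_#|`s|) : 0 <= s`_i.
  have : s`_i \in s by rewrite mem_nth.
  by rewrite in_fset_set//= inE => -[x _ <-].
pose B (i : 'I_#|`s|) := h @^-1` [set s`_i].
have mB i : measurable (B i) by exact: measurable_funPTI.
have mind i : measurable_fun D (fun x => (W x * \1_(B i) (Z x)) : R).
  apply: measurable_funM => //; apply: (@measurable_comp _ _ _ _ _ _ setT) => //.
  exact: measurable_funTS.
transitivity (\sum_(i < #|`s|) ((s`_i)%:E * (c%:E * nu (B i))))%E.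
  transitivity (\int[mu]_(x in D)
      (\sum_(i < #|`s|) (s`_i)%:E * (W x * \1_(B i) (Z x))%:E))%E.
    apply: eq_integral => x _; rewrite fimfunEord mulr_sumr -sumEFin.
    by apply: eq_bigr => i _; rewrite -EFinM mulrCA.
  rewrite ge0_integral_sum//.
  - apply: eq_bigr => i _; rewrite ge0_integralZl ?lee_fin ?WZ//.
    + exact/measurable_EFinP.
    + by move=> x _; rewrite lee_fin mulr_ge0.
  - by move=> i; apply: measurable_funeM; exact/measurable_EFinP.
  - by move=> i x _; rewrite -EFinM lee_fin !mulr_ge0.
have -> : (\int[nu]_y (h y)%:E = \sum_(i < #|`s|) ((s`_i)%:E * nu (B i)))%E.
  transitivity (\int[nu]_y
      (\sum_(i < #|`s|) (s`_i)%:E * (\1_(B i) y)%:E))%E.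
    by apply: eq_integral => y _; rewrite fimfunEord -sumEFin.
  rewrite ge0_integral_sum//.
  - apply: eq_bigr => i _; rewrite ge0_integralZl ?lee_fin//.
    + by rewrite integral_indic// setIT.
    + exact/measurable_EFinP.
  - by move=> i; apply: measurable_funeM; exact/measurable_EFinP.
  - by move=> i x _; rewrite -EFinM lee_fin !mulr_ge0.
rewrite ge0_sume_distrr => [|i _]; last by rewrite mule_ge0 ?lee_fin.
by apply: eq_bigr => i _; rewrite muleCA.
Qed.

(** The identity [WZ] for indicators passes to simple functions by linearity and
    to nonnegative functions by monotone convergence.  With the product of the
    other factors as W it lets one factor of a product of independent variables
    vary; with a density as W it integrates against the law having that
    density. *)
Lemma ge0_integral_of_indic (phi : T' -> R) : (forall y, 0 <= phi y) ->
  measurable_fun setT phi ->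
  (\int[mu]_(x in D) (W x * phi (Z x))%:E = c%:E * \int[nu]_y (phi y)%:E)%E.
Proof.
move=> phi0 mphi.
have mphiE : measurable_fun setT (EFin \o phi) by exact/measurable_EFinP.
pose h := nnsfun_approx measurableT mphiE.
have hcvg y : (h n y)%:E @[n --> \oo] --> (phi y)%:E.
  apply: (@cvg_nnsfun_approx _ _ _ _ measurableT _ mphiE) => //= z _.
  by rewrite lee_fin.
have hnd y m n : (m <= n)%N -> h m y <= h n y.
  by move=> mn; have /lefP := nd_nnsfun_approx measurableT mphiE mn; apply.
have mWZ (g : T' -> R) : measurable_fun setT g ->
    measurable_fun D (fun x => (W x * g (Z x))%:E).
  move=> mg; apply/measurable_EFinP; apply: measurable_funM => //.
  by apply: (@measurable_comp _ _ _ _ _ _ setT) => //; exact: measurable_funTS.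
have L : (\int[mu]_(x in D) (W x * h n (Z x))%:E)%E @[n --> \oo] -->
    (\int[mu]_(x in D) (W x * phi (Z x))%:E)%E.
  rewrite [X in _ --> X](_ : _ = \int[mu]_(x in D)
      limn (fun n => (W x * h n (Z x))%:E))%E; last first.
    apply: eq_integral => x _; apply/esym/cvg_lim => //.
    by under eq_fun do rewrite EFinM; rewrite EFinM; exact: cvgeZl.
  apply: cvg_monotone_convergence => //.
  - by move=> n; apply: mWZ; exact: measurable_funPT.
  - by move=> n x _; rewrite lee_fin mulr_ge0.
  - by move=> x _ m n mn; rewrite lee_fin ler_wpM2l// hnd.
have M : (c%:E * \int[nu]_y (h n y)%:E)%E @[n --> \oo] -->
    (c%:E * \int[nu]_y (phi y)%:E)%E.
  apply: cvgeZl => //.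
  rewrite [X in _ --> X](_ : _ = \int[nu]_y limn (fun n => (h n y)%:E))%E.
    apply: cvg_monotone_convergence => //.
    - by move=> n; apply/measurable_EFinP; exact: measurable_funPT.
    - by move=> n y _; rewrite lee_fin.
    - by move=> y _ m n mn; rewrite lee_fin hnd.
  by apply: eq_integral => y _; apply/esym/cvg_lim.
rewrite -(cvg_lim _ L)// -(cvg_lim _ M)//.
by congr (limn _); apply/funext => n; exact: ext_nnsfun.
Qed.

End Extension.

(** * Products of independent random variables *)

Section Independence.
Context {R : realType} {d : measure_display} {T : measurableType d}.
Local Notation RT := (measurableTypeR R).
Variables (P : probability T R) (I : finType).
Variables (D : set T) (mD : measurable D) (X : I -> T -> RT).
Variables (nu : I -> probability RT R) (c : R).
Hypothesis mX : forall i, measurable_fun setT (X i).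
(* On the event D, of probability c, the X_i are independent with laws nu_i. *)
Hypothesis indepX : forall B : I -> set RT, (forall i, measurable (B i)) ->
  (P (D `&` \bigcap_i X i @^-1` B i) = c%:E * \prod_i nu i (B i))%E.
Implicit Types (phi : I -> R -> R) (s : seq I) (j : I).

Let upd phi j (g : R -> R) : I -> R -> R :=
  fun i => if i == j then g else phi i.

Let prod_upd phi j g (x : I -> R) :
  \prod_i upd phi j g i (x i) = g (x j) * \prod_(i | i != j) phi i (x i).
Proof.
rewrite (bigD1 j)//= {1}/upd eqxx; congr (_ * _).
by apply: eq_bigr => i ij; rewrite /upd (negbTE ij).
Qed.

Let Rint_upd phi j g :
  \prod_i (\int[nu i]_y upd phi j g i y) =
  (\int[nu j]_y g y) * \prod_(i | i != j) (\int[nu i]_y phi i y).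
Proof.
rewrite (bigD1 j)//= {1}/upd eqxx; congr (_ * _).
by apply: eq_bigr => i ij; rewrite /upd (negbTE ij).
Qed.

Let adm phi := (forall i, measurable_fun (setT : set RT) (phi i)) /\
  (forall i, (nu i).-integrable setT (EFin \o phi i)).

Let adm_upd phi j g : adm phi -> measurable_fun (setT : set RT) g ->
  (nu j).-integrable setT (EFin \o g) -> adm (upd phi j g).
Proof.
move=> [mphi iphi] mg ig; split=> i; rewrite /upd; case: eqVneq => // -> //.
Qed.

Let measurable_prod_comp (A : pred I) phi : adm phi ->
  measurable_fun D (fun x => \prod_(i | A i) phi i (X i x)).
Proof.
move=> [mphi _].
under eq_fun do rewrite big_mkcond/=.
apply: measurable_prod => i _; case: (A i) => //.
by apply: (@measurable_comp _ _ _ _ _ _ setT) => //; exact: measurable_funTS.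
Qed.

(** One factor is freed at a time: those outside s are indicators, and
    [ge0_integral_of_indic] applies to the factor j with the product of the
    others as weight. *)
Let ge0_integral_prod_seq s phi : adm phi -> (forall i y, 0 <= phi i y) ->
  (forall i, i \notin s -> exists2 B, measurable B & phi i = \1_B) ->
  (\int[P]_(x in D) (\prod_i phi i (X i x))%:E =
   (c * \prod_i (\int[nu i]_y phi i y))%:E)%E.
Proof.
elim: s phi => [|j s IH] phi aphi phi0 phis.
  have /choice[B BP] i : exists B, measurable B /\ phi i = \1_B.
    by have [//|B mB ->] := phis i; exists B.
  have mB i : measurable (B i : set RT) by case: (BP i).
  transitivity (\int[P]_(x in D) (\1_(\bigcap_i X i @^-1` B i) x)%:E)%E.
    apply: eq_integral => x _; congr (_%:E); rewrite indicE.
    under eq_bigr do rewrite (BP _).2 indicE.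
    have [xB|xB] := boolP (_ \in _).
      rewrite big1// => i _; rewrite mem_set//.
      by move: xB; rewrite inE => /(_ i Logic.I).
    have [i xi] : exists i, ~ B i (X i x).
      apply: contrapT => /forallNP h; move/negP: xB; apply; rewrite inE => i _.
      exact: contrapT (h i).
    by rewrite (bigD1 i)//= memNset// mul0r.
  rewrite integral_indic//; last first.
    apply: fin_bigcap_measurable => // i _.
    by rewrite -[X in measurable X]setTI; exact: mX.
  rewrite setIC; apply: etrans (indepX mB) _.
  rewrite EFinM -prodEFin; congr (_ * _)%E; apply: eq_bigr => i _.
  rewrite (BP i).2 /Rintegral integral_indic// setIT /= fineK//.
  exact: fin_num_measure.
pose W x := \prod_(i | i != j) phi i (X i x).
pose c' := c * \prod_(i | i != j) (\int[nu i]_y phi i y).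
have phiE : phi = upd phi j (phi j).
  by apply/funext => i; rewrite /upd; case: eqVneq => // ->.
transitivity (\int[P]_(x in D) (W x * phi j (X j x))%:E)%E.
  by apply: eq_integral => x _; rewrite {1}phiE prod_upd mulrC.
rewrite (@ge0_integral_of_indic _ _ _ _ _ P (nu j) _ _ W (X j) c')//.
- rewrite {2}phiE Rint_upd mulrCA -/c' mulrC [RHS]EFinM; congr (_ * _)%E.
  rewrite fineK//; apply: integrable_fin_num => //; exact: aphi.2.
- by move=> x; apply: prodr_ge0.
- exact: measurable_prod_comp.
- move=> B mB.
  have : (\int[P]_(x in D) (\prod_i upd phi j \1_B i (X i x))%:E =
      (c * \prod_i (\int[nu i]_y upd phi j \1_B i y))%:E)%E.
    apply: IH.
    - by apply: adm_upd => //; exact: integrable_indic.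
    - by move=> i y; rewrite /upd; case: eqP.
    - move=> i si; rewrite /upd; case: eqVneq => [_|ij]; first by exists B.
      by apply: phis; rewrite inE negb_or ij.
  move=> IHB; apply: etrans (etrans IHB _).
    by apply: eq_integral => x _; rewrite prod_upd mulrC.
  rewrite Rint_upd mulrCA -/c' mulrC [LHS]EFinM /Rintegral.
  rewrite integral_indic// setIT fineK//.
  exact: fin_num_measure.
- exact: aphi.1.
Qed.

Lemma ge0_integral_prod_indep phi :
  (forall i, measurable_fun (setT : set RT) (phi i)) ->
  (forall i, (nu i).-integrable setT (EFin \o phi i)) ->
  (forall i y, 0 <= phi i y) ->
  (\int[P]_(x in D) (\prod_i phi i (X i x))%:E =
   (c * \prod_i (\int[nu i]_y phi i y))%:E)%E.
Proof.
move=> mphi iphi phi0; apply: (@ge0_integral_prod_seq (enum I)) => //.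
by move=> i; rewrite mem_enum.
Qed.

Lemma integrable_prod_indep phi :
  (forall i, measurable_fun (setT : set RT) (phi i)) ->
  (forall i, (nu i).-integrable setT (EFin \o phi i)) ->
  P.-integrable D (fun x => (\prod_i phi i (X i x))%:E).
Proof.
move=> mphi iphi; apply/integrableP; split.
  by apply/measurable_EFinP; exact: measurable_prod_comp.
under eq_integral do rewrite abse_EFin normr_prod.
rewrite (@ge0_integral_prod_indep (fun i y => `|phi i y|)) ?ltry//.
- by move=> i; exact: measurableT_comp.
- by move=> i; have := integrable_abse (iphi i).
Qed.

(** A signed factor phi_j is the difference of the nonnegative functions
    phi_j + |phi_j| and |phi_j|, and both sides are linear in it. *)
Let integral_prod_seq s phi : adm phi ->
  (forall i, i \notin s -> forall y, 0 <= phi i y) ->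
  \int[P]_(x in D) (\prod_i phi i (X i x)) =
  c * \prod_i (\int[nu i]_y phi i y).
Proof.
elim: s phi => [|j s IH] phi aphi phi0.
  by rewrite [LHS]/Rintegral ge0_integral_prod_indep//; case: aphi => // ? ?; auto.
have mj := aphi.1 j; have ij := aphi.2 j.
pose f y := phi j y + `|phi j y|; pose g y := `|phi j y|.
have mg : measurable_fun (setT : set RT) g by exact: measurableT_comp.
have mf : measurable_fun (setT : set RT) f by exact: measurable_funD.
have ig : (nu j).-integrable setT (EFin \o g) by exact: (integrable_abse ij).
have if_ : (nu j).-integrable setT (EFin \o f).
  by rewrite [X in _.-integrable _ X](_ : _ = (EFin \o phi j) \+ (EFin \o g))%E//;
    by apply: integrableD.
have af : adm (upd phi j f) by exact: adm_upd.
have ag : adm (upd phi j g) by exact: adm_upd.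
have pos h : (forall y, 0 <= h y) -> forall i, i \notin s ->
    forall y, 0 <= upd phi j h i y.
  move=> h0 i si y; rewrite /upd; case: eqVneq => // ij'.
  by apply: phi0; rewrite inE negb_or ij'.
have phiE : phi = upd phi j (phi j).
  by apply/funext => i; rewrite /upd; case: eqVneq => // ->.
transitivity (\int[P]_(x in D) ((\prod_i upd phi j f i (X i x)) -
    \prod_i upd phi j g i (X i x))).
  apply: eq_Rintegral => x _; rewrite !prod_upd {1}phiE prod_upd.
  by rewrite -mulrBl addrK.
rewrite RintegralB//; last 2 first.
- by apply: integrable_prod_indep; case: af.
- by apply: integrable_prod_indep; case: ag.
rewrite !IH//; last 2 first.
- by apply: pos => y; rewrite /g.
- by apply: pos => y; have := ler_norm (- phi j y); rewrite normrN /f; lra.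
rewrite !Rint_upd {3}phiE Rint_upd -mulrBr -mulrBl; congr (_ * (_ * _)).
by rewrite -RintegralB//; apply: eq_Rintegral => y _; rewrite /f addrK.
Qed.

Lemma integral_prod_indep phi :
  (forall i, measurable_fun (setT : set RT) (phi i)) ->
  (forall i, (nu i).-integrable setT (EFin \o phi i)) ->
  \int[P]_(x in D) (\prod_i phi i (X i x)) =
  c * \prod_i (\int[nu i]_y phi i y).
Proof.
move=> mphi iphi; apply: (@integral_prod_seq (enum I)) => //.
by move=> i; rewrite mem_enum.
Qed.

End Independence.

(** * Moments of the standard normal law *)

Section NormalMoments.
Context {R : realType}.
Local Notation RT := (measurableTypeR R).
Local Notation mu := (@lebesgue_measure R).
Local Notation N01 := (normal_prob (0 : R) 1).

Let p : R -> R := normal_pdf 0 1.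

Let pE x : p x = normal_peak 1 * expR (- (x ^+ 2 / 2)).
Proof.
rewrite /p /normal_pdf oner_eq0 /normal_fun subr0.
by rewrite expr1n mulNr.
Qed.

Let p_ge0 x : 0 <= p x. Proof. exact: normal_pdf_ge0. Qed.

Let pN x : p (- x) = p x. Proof. by rewrite !pE sqrrN. Qed.

Let cp : continuous p.
Proof. by apply: continuous_normal_pdf; rewrite oner_eq0. Qed.

Let mp : measurable_fun (setT : set RT) p.
Proof. exact: measurable_normal_pdf. Qed.

Lemma ge0_integral_normal (phi : R -> R) : (forall x, 0 <= phi x) ->
  measurable_fun (setT : set RT) phi ->
  (\int[N01]_x (phi x)%:E = \int[mu]_x (p x * phi x)%:E)%E.
Proof.
move=> phi0 mphi.
rewrite (@ge0_integral_of_indic _ _ _ _ _ mu N01 _ _ p idfun 1) ?mul1e//.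
  by move=> _ B mB; rewrite setTI.
move=> B mB; rewrite mul1e /= /normal_prob [RHS]integral_mkcond.
apply: eq_integral => x _; rewrite patchE indicE.
by case: (x \in B); rewrite ?mulr1 ?mulr0.
Qed.

(** The differential equation p' = - x p of the density replaces its explicit
    form below. *)
Let dp (x : R) : is_derive x 1 p (- (x * p x)).
Proof.
have -> : p = (fun x => normal_peak 1 * expR (- (x ^+ 2 / 2))).
  by apply/funext => y; rewrite pE.
apply: is_derive_eq; rewrite /GRing.scale/=; by field.
Qed.

Let ftc (F f : R -> R) n : (forall x : R, is_derive x 1 F (f x)) ->
  continuous f ->
  (\int[mu]_(x in `[0%R, n.+1%:R : R]) (f x)%:E = (F n.+1%:R - F 0%R)%:E)%E.
Proof.
move=> dF cf; rewrite EFinB; apply: continuous_FTC2 => //.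
- by apply: continuous_subspaceT.
- have cF : continuous F.
    by move=> x; apply/differentiable_continuous/derivable1_diffP; case: (dF x).
  split.
  + by move=> x _; case: (dF x).
  + by apply: cvg_at_right_filter; exact: cF.
  + by apply: cvg_at_left_filter; exact: cF.
- by move=> x _; rewrite derive1E; apply: derive_val.
Qed.


Let xp k (x : R) := x ^+ k * p x.

Let cxp k : continuous (xp k).
Proof. by move=> x; apply: cvgM; [exact: exprn_continuous|exact: cp]. Qed.

Let mxp k : measurable_fun (setT : set RT) (xp k).
Proof. exact: continuous_measurable_fun. Qed.

Let dxp k (x : R) : is_derive x 1 (xp k.+1) (k.+1%:R * xp k x - xp k.+2 x).
Proof.
have -> : xp k.+1 = ((@id R) ^+ k.+1 * p)%R.
  by apply/funext => y; rewrite /xp fctE exprfctE.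
have h := is_deriveM (is_deriveX k.+1 (is_derive_id x (1 : R))) (dp x).
apply: (is_derive_eq h).
by rewrite /xp /GRing.scale/= fctE !exprS; ring.
Qed.

(** The difference of the two sides is the integral of the derivative of
    x^(k+1) p, that is, the nonnegative value of x^(k+1) p at the right end. *)
Let moment_step k n :
  (\int[mu]_(x in `[0%R, n.+1%:R : R]) (xp k.+2 x)%:E <=
   k.+1%:R%:E * \int[mu]_(x in `[0%R, n.+1%:R : R]) (xp k x)%:E)%E.
Proof.
have ixp j : mu.-integrable `[0%R, n.+1%:R : R] (EFin \o xp j).
  apply: continuous_compact_integrable; first exact: segment_compact.
  by apply: continuous_subspaceT; exact: cxp.
have : (\int[mu]_(x in `[0%R, n.+1%:R : R])
    (k.+1%:R * xp k x - xp k.+2 x)%:E = (xp k.+1 n.+1%:R - xp k.+1 0%R)%:E)%E.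
  apply: ftc; first exact: dxp.
  by move=> x; apply: cvgB; [apply: cvgMr|]; exact: cxp.
under eq_integral do rewrite EFinB EFinM.
rewrite integralB//=; last 2 first.
- exact: (integrableZl _ k.+1%:R (ixp k)).
- exact: ixp.
rewrite integralZl//=; last exact: ixp.
move=> h; rewrite -sube_ge0; last first.
  by apply/orP; left; apply: integrable_fin_num => //; exact: ixp.
by rewrite h lee_fin {2}/xp expr0n mul0r subr0 /xp mulr_ge0// exprn_ge0.
Qed.

Let half_moment_step k : ~~ odd k ->
  (\int[mu]_(x in `[0%R, +oo[) (xp k.+2 x)%:E <=
   k.+1%:R%:E * \int[mu]_(x in `[0%R, +oo[) (xp k x)%:E)%E.
Proof.
move=> ek.
have c j : ~~ odd j ->
    (\int[mu]_(x in `[0%R, n.+1%:R : R]) (xp j x)%:E)%E @[n --> \oo]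
    --> (\int[mu]_(x in `[0%R, +oo[) (xp j x)%:E)%E.
  move=> ej; rewrite (cvg_shiftS (fun n =>
    \int[mu]_(x in `[0%R, n%:R : R]) (xp j x)%:E)%E).
  apply: ge0_cvgn_integral; last exact: mxp.
  by move=> x; rewrite /xp mulr_ge0// exprn_even_ge0.
have c1 := c k.+2; have c2 := c k; rewrite /= negbK in c1.
have {}c1 := c1 ek.
have {}c2 := cvgeZl (erefl : k.+1%:R%:E \is a fin_num) (c2 ek).
rewrite -(cvg_lim _ c1)// -(cvg_lim _ c2)//; apply: lee_lim.
- by apply/cvg_ex; eexists; exact: c1.
- by apply/cvg_ex; eexists; exact: c2.
- by apply: nearW => n; exact: moment_step.
Qed.

(** Integration by parts, as an inequality: the boundary term has a sign, so its
    limit at infinity does not have to be computed. *)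
Lemma normal_even_moment_step k : ~~ odd k ->
  (\int[N01]_x (x ^+ k.+2)%:E <= k.+1%:R%:E * \int[N01]_x (x ^+ k)%:E)%E.
Proof.
move=> ek.
have half j : ~~ odd j -> (\int[N01]_x (x ^+ j)%:E =
    2%:E * \int[mu]_(x in `[0%R, +oo[) (xp j x)%:E)%E.
  move=> ej; rewrite ge0_integral_normal//; last first.
    by move=> x; exact: exprn_even_ge0.
  under eq_integral do rewrite mulrC.
  rewrite (@ge0_symfun_integralT _ (xp j)) ?set_itvcy//.
  - by move=> x; rewrite /xp mulr_ge0// exprn_even_ge0.
  - by move=> x; rewrite /xp /= exprNn pN -signr_odd (negbTE ej) expr0 mul1r.
rewrite !half//= ?negbK// muleCA lee_wpmul2l//; exact: half_moment_step.
Qed.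

Lemma normal_moment2 : (\int[N01]_x (x ^+ 2)%:E <= 1)%E.
Proof.
apply: le_trans (@normal_even_moment_step 0 isT) _.
under eq_integral do rewrite expr0.
by rewrite mul1e integral_cst//= mul1e probability_setT.
Qed.

Lemma normal_moment4 : (\int[N01]_x (x ^+ 4)%:E <= 3%:E)%E.
Proof.
apply: le_trans (@normal_even_moment_step 2 isT) _.
by rewrite -[leRHS]mule1 lee_wpmul2l// normal_moment2.
Qed.

(** For k <= 4 the power |x|^k is dominated by 1 + x^4. *)
Lemma normal_integrable_exp k : (k <= 4)%N ->
  N01.-integrable setT (fun x => (x ^+ k)%:E).
Proof.
move=> k4.
have i4 : N01.-integrable setT (fun x => (x ^+ 4)%:E).
  apply/integrableP; split.
    by apply/measurable_EFinP; exact: exprn_measurable.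
  apply: le_lt_trans (_ : 3%:E < +oo)%E; last exact: ltry.
  apply: le_trans normal_moment4.
  by under eq_integral do rewrite gee0_abs ?lee_fin ?exprn_even_ge0//.
have i1 : N01.-integrable setT (fun x => (1 + x ^+ 4)%:E).
  rewrite [X in _.-integrable _ X](_ : _ =
    cst 1%E \+ (fun x => (x ^+ 4)%:E))%E//.
  apply: integrableD => //; exact: finite_measure_integrable_cst.
apply: le_integrable i1 => //.
  by apply/measurable_EFinP; exact: exprn_measurable.
move=> x _; rewrite !abse_EFin lee_fin [leRHS]ger0_norm; last first.
  by rewrite addr_ge0// exprn_even_ge0.
rewrite normrX; have [x1|x1] := leP `|x| 1.
  by rewrite (@le_trans _ _ 1)// ?exprn_ile1// lerDl exprn_even_ge0.
apply: (@le_trans _ _ (`|x| ^+ 4)); first by rewrite ler_weXn2l// ltW.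
by rewrite -normrX ger0_norm ?exprn_even_ge0// lerDr.
Qed.

Let ge0_integralN (g : R -> R) : (forall x, 0 <= g x) ->
  measurable_fun (setT : set RT) g ->
  (\int[mu]_x (g x)%:E = \int[mu]_x (g (- x))%:E)%E.
Proof.
move=> g0 mg.
transitivity (\int[mu]_(x in (-%R : RT -> RT) @^-1` setT)
    ((EFin \o g) \o (-%R : RT -> RT)) x)%E => //.
rewrite -ge0_integral_pushforward//=.
- by apply: eq_measure_integral => //= A mA _; exact/esym/lebesgue_measureN.
- exact/measurable_EFinP.
- by move=> x _; rewrite lee_fin.
Qed.

(** The density is even, so the positive and the negative parts of the identity
    have the same integral. *)
Lemma normal_mean : \int[N01]_x x = 0.
Proof.
have i1 : N01.-integrable setT (fun x => x%:E).
  exact: (@normal_integrable_exp 1).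
have sym : (\int[N01]_x (Num.max x 0)%:E = \int[N01]_x (Num.max (- x) 0)%:E)%E.
  have mm : measurable_fun (setT : set RT) (fun x : R => Num.max x 0).
    exact: measurable_maxr.
  rewrite !ge0_integral_normal//.
  rewrite (@ge0_integralN (fun x => p x * Num.max x 0)).
  - by apply: eq_integral => x _; rewrite pN.
  - by move=> x; rewrite mulr_ge0// le_max lexx orbT.
  - exact: measurable_funM.
  - by move=> x; rewrite le_max lexx orbT.
  - by apply: measurable_maxr => //; exact: oppr_measurable.
  - by move=> x; rewrite le_max lexx orbT.
suff h : (\int[N01]_x x%:E = 0)%E by exact: (congr1 fine h).
rewrite [LHS]integralE.
have -> : (\int[N01]_x ((fun x => x%:E)^\+ x) = \int[N01]_x (Num.max x 0)%:E)%E.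
  by apply: eq_integral => x _; rewrite funeposE -EFin_max.
have -> : (\int[N01]_x ((fun x => x%:E)^\- x) = \int[N01]_x (Num.max x 0)%:E)%E.
  by rewrite sym; apply: eq_integral => x _; rewrite funenegE -EFinN -EFin_max.
rewrite subee//.
have := integrable_fin_num measurableT (integrable_funepos measurableT i1).
congr (_ \is a fin_num).
by apply: eq_integral => x _; rewrite funeposE -EFin_max.
Qed.

End NormalMoments.

Lemma std_gaussian_box (R : realType) k (B : 'I_k -> set (measurableTypeR R)) :
  (forall i, measurable (B i)) ->
  (std_gaussian k [set z | forall i, B i (tnth z i)] =
   \prod_(i < k) normal_prob 0 1 (B i))%E.
Proof.
elim: k B => [|k IH] B mB.
  rewrite big_ord0 /= diracE mem_set//; by case.
pose S := [set z : k.-tuple (measurableTypeR R) |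
  forall i, B (lift ord0 i) (tnth z i)].
have mS : measurable S.
  have -> : S = \bigcap_i (fun z => tnth z i) @^-1` B (lift ord0 i).
    by apply/seteqP; split=> [z Sz i _|z Sz i]; exact: Sz.
  apply: fin_bigcap_measurable => // i _.
  by rewrite -[X in measurable X]setTI; exact: measurable_tnth.
rewrite big_ord_recl -IH; last by move=> i; exact: mB.
rewrite -product_measure1E//.
suff <- : @tcons R k @^-1` [set z | forall i, B i (tnth z i)] = B ord0 `*` S.
  by [].
apply/seteqP; split=> [[a z] Bz|[a z] [Ba Sz] i].
  split; first by have := Bz ord0; rewrite tnth0.
  by move=> i; have := Bz (lift ord0 i); rewrite tnthS.
case: (unliftP ord0 i) => [j ->|->]; first by rewrite tnthS; exact: Sz.
by rewrite tnth0.
Qed.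

(** * Tails of the level distribution *)

Section Tail.
Context {R : realType}.
Variables (PK : probability nat R) (PKP : infinite_support_pos PK).
Local Notation t := (tail PK).
Local Notation from i := [set k | (i <= k)%N].

Lemma tailE i : PK (from i) = (t i)%:E.
Proof. by rewrite /tail fineK// fin_num_measure. Qed.

Lemma from_setU i : from i = [set i] `|` from i.+1.
Proof.
apply/seteqP; split=> k /=; last by case=> [->//|/ltnW].
by rewrite leq_eqVlt => /predU1P[->|]; [left|right].
Qed.

Lemma from_disj i : [disjoint [set i] & from i.+1].
Proof. by apply/disj_setPLR => k /= -> /=; rewrite ltnn. Qed.

Lemma tail_ge0 i : 0 <= t i. Proof. by rewrite fine_ge0. Qed.

Lemma tail_nincr i j : (i <= j)%N -> t j <= t i.
Proof.
move=> ij; rewrite -lee_fin -!tailE; apply: le_measure; rewrite ?inE//.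
by move=> k /=; exact: leq_trans.
Qed.

Lemma tail_gt0 i : 0 < t i.
Proof.
rewrite lt_neqAle tail_ge0 andbT eq_sym; apply/eqP => ti0.
apply: PKP.2; apply: (@sub_finite_set _ _ `I_i); last exact: finite_II.
move=> k /= pk; rewrite ltnNge; apply: contra pk => ik.
rewrite eq_le measure_ge0 andbT.
have : (PK [set k] <= PK (from i))%E.
  by apply: le_measure; rewrite ?inE// => _ /= ->.
by rewrite tailE ti0.
Qed.

Lemma tailS i : t i = fine (PK [set i]) + t i.+1.
Proof.
apply/EFin_inj; rewrite EFinD fineK ?fin_num_measure// -!tailE.
rewrite {1}from_setU measureU//; last by apply/disj_set2P; exact: from_disj.
by rewrite fineK ?fin_num_measure.
Qed.

Lemma cvg_tail : t i @[i --> \oo] --> 0.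
Proof.
have : PK (from i) @[i --> \oo] --> PK (\bigcap_i from i).
  apply: nonincreasing_cvg_mu => //.
  - by rewrite (le_lt_trans (probability_le1 _ _))// ltry.
  by move=> i j ij; apply/subsetPset => k /=; exact: leq_trans.
have -> : \bigcap_i from i = set0.
  by apply/seteqP; split=> // k /(_ k.+1 Logic.I)/=; rewrite ltnn.
rewrite measure0; under eq_fun do rewrite tailE.
by move/fine_cvgP => [].
Qed.

Let integrable_tail i : PK.-integrable (from i) (EFin \o t).
Proof.
apply: (@le_integrable _ _ _ PK _ _ _ (cst 1%E)) => //.
  move=> k _; rewrite /= lee_fin normr1 ger0_norm ?tail_ge0//.
  by rewrite -lee_fin -tailE probability_le1.
exact: finite_measure_integrable_cst.
Qed.

Let mean_tailS i : \int[PK]_(k in from i) t k =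
  t i * fine (PK [set i]) + \int[PK]_(k in from i.+1) t k.
Proof.
rewrite {1}from_setU Rintegral_setU//.
- congr (_ + _); transitivity (\int[PK]_(k in [set i]) (t i)).
    by apply: eq_Rintegral => k; rewrite inE => ->.
  exact: Rintegral_cst.
- by rewrite -from_setU; exact: integrable_tail.
- exact: from_disj.
Qed.

(** With p_k = t_k - t_(k+1) one has p_k t_k >= (t_k^2 - t_(k+1)^2) / 2; the
    right-hand sides telescope and t_n tends to 0. *)
Lemma mean_tail_ge i : t i ^+ 2 / 2 <= \int[PK]_(k in from i) t k.
Proof.
have step n : t i ^+ 2 / 2 - t (i + n) ^+ 2 / 2 <= \int[PK]_(k in from i) t k.
  suff : t i ^+ 2 / 2 - t (i + n) ^+ 2 / 2 +
      \int[PK]_(k in from (i + n)) t k <= \int[PK]_(k in from i) t k.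
    apply: le_trans; rewrite lerDl; apply: Rintegral_ge0 => k _.
    exact: tail_ge0.
  elim: n => [|n]; first by rewrite addn0 subrr add0r.
  apply: le_trans; rewrite addnS [in leRHS]mean_tailS addrA lerD2r.
  have := tailS (i + n); set p := fine _ => ->.
  have p0 : 0 <= p by rewrite fine_ge0.
  have := tail_ge0 (i + n).+1; nra.
have L : t i ^+ 2 / 2 - t (i + n) ^+ 2 / 2 @[n --> \oo] --> t i ^+ 2 / 2.
  rewrite -[X in _ --> X]subr0; apply: cvgB; first exact: cvg_cst.
  rewrite -[X in _ --> X](_ : 0 ^+ 2 / 2 = 0); last by rewrite expr0n mul0r.
  apply: cvgMl; rewrite expr2; under eq_fun do rewrite expr2.
  have ct : t (i + n) @[n --> \oo] --> 0.
    by apply: cvg_comp cvg_tail; exact: cvg_addnl.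
  exact: cvgM.
rewrite -(cvg_lim _ L)//; apply: limr_le.
  by apply/cvg_ex; eexists; exact: L.
exact: nearW.
Qed.

(** The spectrum of the preconditioner is compared with the tails: for
    lambda = t the weight 1 / gamma_i is at most 2 / t_i. *)
Lemma gamma_tail_ge i : t i / 2 <= gamma PK t i.
Proof.
rewrite /gamma ler_pdivlMr ?tail_gt0// mulrAC -expr2; exact: mean_tail_ge.
Qed.

(** E[sum_(j < K) w_j] = sum_j w_j P(K > j), by exchanging the summations. *)
Lemma sum_tail (w : nat -> R) : (forall j, 0 <= w j) ->
  (\sum_(0 <= k <oo) PK [set k] * (\sum_(j < k) w j)%:E =
   \sum_(0 <= j <oo) (w j * t j.+1)%:E)%E.
Proof.
move=> w0.
have w1 k j : (0 <= PK [set k] * (w j * \1_(from j.+1) k)%:E)%E.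
  by rewrite mule_ge0 ?measure_ge0// lee_fin mulr_ge0.
transitivity (\sum_(0 <= k <oo) \sum_(0 <= j <oo)
    PK [set k] * (w j * \1_(from j.+1) k)%:E)%E.
  apply: eq_eseriesr => k _.
  rewrite (nneseries_split 0 k)//= add0n.
  rewrite [X in (_ + X)%E]eseries0 ?adde0; last first.
    by move=> j kj _; rewrite indicE memNset ?mulr0 ?mule0//= ltnNge kj.
  rewrite -ge0_sume_distrr; last by move=> j _; rewrite lee_fin mulr_ge0.
  rewrite sumEFin; congr (_ * _%:E)%E; rewrite big_mkord.
  by apply: eq_bigr => j _; rewrite indicE mem_set ?mulr1//=.
rewrite nneseries_interchange//; apply: eq_eseriesr => j _.
transitivity (\sum_(0 <= k <oo) (w j)%:E * PK ([set k] `&` from j.+1))%E.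
  apply: eq_eseriesr => k _; rewrite indicE.
  have [jk|jk] := boolP (k \in _).
    rewrite mulr1 muleC (_ : _ `&` _ = [set k])//.
    by apply/setIidPl => _ /= ->; move: jk; rewrite inE.
  rewrite mulr0 mule0 (_ : _ `&` _ = set0) ?measure0 ?mule0//.
  by apply/seteqP; split=> // l [/= ->]; move: jk; rewrite notin_setE.
rewrite nneseriesZl// EFinM; congr (_ * _)%E; rewrite -tailE.
rewrite -measure_semi_bigcup//.
- by rewrite -setI_bigcupl bigcup_imset1 image_id setTI.
- apply/trivIsetP => a b _ _ ab; apply/seteqP.
  by split=> // l [[/= -> _] [/= e _]]; rewrite e eqxx in ab.
Qed.

End Tail.

(** * The iterates as functions of the past *)

(** The random number of summands of an estimate is handled by fixing the
    level. *)
Lemma measurable_fun_switch d d' (T : measurableType d) (T' : measurableType d')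
    (K : T -> nat) (f : nat -> T -> T') :
  (forall k, measurable (K @^-1` [set k])) ->
  (forall k, measurable_fun setT (f k)) ->
  measurable_fun setT (fun x => f (K x) x).
Proof.
move=> mK mf _ B mB; rewrite setTI.
have -> : (fun x => f (K x) x) @^-1` B =
    \bigcup_k (K @^-1` [set k] `&` f k @^-1` B).
  by apply/seteqP; split=> [x /= fB|x [k _ [/= <-]]//]; exists (K x).
apply: bigcupT_measurable => k; apply: measurableI => //.
by rewrite -[X in measurable X]setTI; exact: mf.
Qed.

Section Iterates.
Context {R : realType} {H : completeNormedModType R}.
Variables (dot : H -> H -> R) (dotP : is_inner_product dot).
Variables (e : nat -> H) (eP : orthonormal_seq dot e) (e_dense : dense_span e).
Variables (Rf : H -> R) (grad : H -> H) (gradP : is_gradient dot Rf grad).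
Context {d : measure_display} {Omega : measurableType d}.
Variable P : probability Omega R.
Variables (lam : nat -> R) (M : nat -> nat) (alpha : nat -> R) (h1 : H).
Variables (K : nat -> Omega -> nat) (v : nat -> nat -> Omega -> H).
Variables (PK : probability nat R) (nu : nat -> set H -> \bar R).
Hypothesis sampling : fgfd_sampling P M K v PK nu.

Local Notation iter := (fgfd_iter Rf lam M alpha h1 K v).
Local Notation ghat := (fgfd_ghat Rf lam M alpha h1 K v).

(** The generating family of the sigma-algebra [past], which makes it the
    sigma-algebra of a measurable type. *)
Definition past_gen (n : nat) : set (set Omega) := [set A | exists j k,
  (j < n)%N /\ (A = K j @^-1` [set k] \/
    exists m B, [/\ (m < M k)%N, borel_H B
                  & A = K j @^-1` [set k] `&` v j m @^-1` B])].

Local Notation pastT n := (g_sigma_algebraType (past_gen n)).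

Lemma measurable_level j k : measurable (K j @^-1` [set k]).
Proof.
by rewrite -[X in measurable X]setTI; exact: (fgfd_measurable_K sampling).
Qed.

Lemma past_gen_measurable n : past_gen n `<=` measurable.
Proof.
move=> A [j [k [_ [->|[m [B [mk bB ->]]]]]]]; first exact: measurable_level.
apply: measurableI; first exact: measurable_level.
exact: (fgfd_measurable_v sampling).
Qed.

Lemma past_measurable n : past M K v n `<=` measurable.
Proof. exact: sub_sigma_measurable (@past_gen_measurable n). Qed.

Lemma past_level n j k : (j < n)%N ->
  measurable (K j @^-1` [set k] : set (pastT n)).
Proof. by move=> jn; apply: sub_sigma_algebra; exists j, k; split=> //; left. Qed.

(** The past only knows v j m on the event m < M (K j).  Off this event the
    value does not enter the estimate and is replaced by 0, which makes the
    direction a function of the past. *)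
Definition drawn j m (x : Omega) : H :=
  if (m < M (K j x))%N then v j m x else 0.

Lemma drawn_borel n j m : (j < n)%N ->
  borel_measurable (T := pastT n) (drawn j m).
Proof.
move=> jn B bB.
have -> : drawn j m @^-1` B = \bigcup_k (K j @^-1` [set k] `&`
    if (m < M k)%N then K j @^-1` [set k] `&` v j m @^-1` B
    else [set _ | B 0]).
  apply/seteqP; split=> x; rewrite /drawn/=.
    by move=> xB; exists (K j x) => //; split=> //; move: xB; case: ifP.
  by case=> k _ [/= ->]; case: ifP => // _ [].
apply: bigcupT_measurable => k; apply: measurableI; first exact: past_level.
case: ifP => mk.
  by apply: sub_sigma_algebra; exists j, k; split=> //; right; exists m, B.
have [B0|B0] := pselect (B 0).
  by rewrite (_ : [set _ | _] = setT)//; apply/seteqP; split.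
by rewrite (_ : [set _ | _] = set0)//; apply/seteqP; split.
Qed.

Lemma ghatE n x : ghat n x = (lam (K n x) / (M (K n x))%:R) *:
  \sum_(m < M (K n x)) dot (grad (iter n x)) (drawn n m x) *: drawn n m x.
Proof.
rewrite /fgfd_ghat /fgfd_grad; congr (_ *: _); apply: eq_bigr => m _.
by rewrite /drawn ltn_ord (derive_grad gradP).
Qed.

Let coord_measurable_ghat_step n j : (j < n)%N ->
  coord_measurable (T := pastT n) dot e (iter j) ->
  coord_measurable (T := pastT n) dot e (ghat j).
Proof.
move=> jn mj i.
pose F k x := (lam k / (M k)%:R) *:
  \sum_(m < M k) dot (grad (iter j x)) (drawn j m x) *: drawn j m x.
under eq_fun do rewrite ghatE -/(F _ _).
apply: (@measurable_fun_switch _ _ (pastT n) _ (K j)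
  (fun k x => dot (F k x) (e i))).
  by move=> k; exact: past_level.
move=> k.
have mv m : coord_measurable (T := pastT n) dot e (drawn j m).
  by apply: borel_coord => //; exact: drawn_borel.
apply: (coord_measurableZ dotP) => //.
apply: (coord_measurable_sum dotP) => m; apply: (coord_measurableZ dotP) => //.
apply: (measurable_dot dotP eP e_dense) => //.
exact: (coord_measurable_grad dotP eP e_dense gradP).
Qed.

Lemma coord_measurable_iter n j : (j <= n)%N ->
  coord_measurable (T := pastT n) dot e (iter j).
Proof.
elim: j => [|j IH] jn; first exact: coord_measurable_cst.
apply: (coord_measurableB dotP); first exact: (IH (ltnW jn)).
apply: (coord_measurableZ dotP) => //.
by apply: coord_measurable_ghat_step => //; exact: (IH (ltnW jn)).
Qed.

Lemma coord_measurable_ghat n j : (j < n)%N ->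
  coord_measurable (T := pastT n) dot e (ghat j).
Proof.
move=> jn; apply: coord_measurable_ghat_step => //.
exact: (coord_measurable_iter (ltnW jn)).
Qed.

Lemma sigma_iter_past n : sigma_iter Rf lam M alpha h1 K v n `<=` past M K v n.
Proof.
apply: smallest_sub; first exact: smallest_sigma_algebra.
move=> A [j [B [jn bB ->]]].
exact: (coord_borel dotP eP e_dense (coord_measurable_iter jn) bB).
Qed.

Lemma measurable_ghat_coord n i :
  measurable_fun setT (fun x => dot (ghat n x) (e i)).
Proof.
apply: (sub_sigma_measurable_fun (@past_gen_measurable n.+1)).
exact: coord_measurable_ghat.
Qed.

Lemma measurable_grad_coord n i : measurable_fun (setT : set (pastT n))
  (fun x => dot (grad (iter n x)) (e i)).
Proof.
exact: (coord_measurable_grad dotP eP e_dense gradP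
  (coord_measurable_iter (leqnn n))).
Qed.

End Iterates.

(** * The law of a direction in the Gram-Schmidt basis *)

Section DirectionLaw.
Context {R : realType} {H : completeNormedModType R}.
Variables (dot : H -> H -> R) (dotP : is_inner_product dot).
Variables (b : nat -> H) (bP : is_prebasis b).
Variables (Rm : forall k, 'M[R]_k) (RmP : forall k, is_QR dot b (Rm k)).
Variables (PK : probability nat R) (PKP : infinite_support_pos PK).
Local Notation e := (gram_schmidt dot b).
Local Notation t := (tail PK).
Local Notation nu := (dir_law PK b Rm).
Local Notation HT := (g_sigma_algebraType (@open H)).

Let eP : orthonormal_seq dot e := gram_schmidt_orthonormal dotP bP RmP.

Lemma borel_coord_preimage i (B : set (measurableTypeR R)) : measurable B ->
  borel_H ((fun h => dot h (e i)) @^-1` B).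
Proof.
move=> mB; have bid : borel_measurable (T := HT) (@id H) by [].
by have := borel_coord dotP e bid i measurableT mB; rewrite setTI.
Qed.

Let zdir k (z : k.-tuple (measurableTypeR R)) : H :=
  synth b (invmx (Rm k) *m
    (diag_mx (\row_(i < k) (Num.sqrt (t i.+1))^-1) *m \col_i tnth z i)).

Let zdirE k z : @zdir k z =
  \sum_(i < k) ((Num.sqrt (t i.+1))^-1 * tnth z i) *: e i.
Proof.
rewrite /zdir (synth_invR RmP); apply: eq_bigr => i _; congr (_ *: _).
by rewrite mul_diag_mx !mxE.
Qed.

Lemma dir_law_setT k : nu k setT = 1%E.
Proof. exact: probability_setT. Qed.

Definition dir_box k (B : 'I_k -> set (measurableTypeR R)) : set H :=
  [set h | forall j : 'I_k, B j (dot h (e j) * Num.sqrt (t j.+1))].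

Lemma borel_dir_box k (B : 'I_k -> set (measurableTypeR R)) :
  (forall j, measurable (B j)) -> borel_H (dir_box B).
Proof.
move=> mB; have -> : dir_box B = \bigcap_(j in [set: 'I_k])
    ((fun h => dot h (e j)) @^-1` ((fun r => r * Num.sqrt (t j.+1)) @^-1` B j)).
  by apply/seteqP; split=> [h hB j _|h hB j]; exact: hB.
apply: (@fin_bigcap_measurable _ HT) => // j _; apply: borel_coord_preimage.
have mm : measurable_fun (setT : set (measurableTypeR R))
    (fun r : R => r * Num.sqrt (t j.+1)) by exact: measurable_funM.
by rewrite -[X in measurable X]setTI; exact: (mm measurableT _ (mB j)).
Qed.

(** The scaling in [dir_box] undoes the factor T_k^(-1/2) and leaves the
    standard normal coordinates. *)
Lemma dir_law_box k (B : 'I_k -> set (measurableTypeR R)) :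
  (forall j, measurable (B j)) ->
  nu k (dir_box B) = (\prod_(j < k) normal_prob 0 1 (B j))%E.
Proof.
move=> mB; rewrite -std_gaussian_box// /dir_law; congr (std_gaussian k _).
apply/seteqP; split=> z /= zB j; have := zB j; rewrite -/(zdir z) zdirE.
  rewrite (dot_sum_orthonormal dotP eP) mulrAC mulVf ?mul1r//.
  by rewrite gt_eqF// sqrtr_gt0 tail_gt0.
rewrite (dot_sum_orthonormal dotP eP) mulrAC mulVf ?mul1r//.
by rewrite gt_eqF// sqrtr_gt0 tail_gt0.
Qed.

Lemma borel_dir_orth l : borel_H [set h | dot h (e l) = 0].
Proof.
have -> : [set h | dot h (e l) = 0] = (fun h => dot h (e l)) @^-1` [set 0].
  by [].
exact: borel_coord_preimage.
Qed.

Lemma dir_law_orth k l : (k <= l)%N -> nu k [set h | dot h (e l) = 0] = 1%E.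
Proof.
move=> kl; rewrite -(dir_law_setT k); congr (std_gaussian k _).
apply/seteqP; split=> // z _ /=; rewrite -/(zdir z) zdirE.
exact: (dot_sum_orthonormal0 dotP eP).
Qed.

End DirectionLaw.

(** * Fourfold products of independent normal variables *)

Section FourfoldMoments.
Context {R : realType}.
Local Notation N01 := (normal_prob (0 : R) 1).

Definition normal_moment k : R := \int[N01]_x (x ^+ k).
Local Notation mom := normal_moment.

Lemma normal_moment0 : mom 0 = 1.
Proof.
rewrite /mom; under eq_Rintegral do rewrite expr0.
by rewrite Rintegral_cst//= probability_setT mulr1.
Qed.

Lemma normal_moment1 : mom 1 = 0. Proof. exact: normal_mean. Qed.

Lemma normal_moment_ge0 k : ~~ odd k -> 0 <= mom k.
Proof. by move=> ek; apply: Rintegral_ge0 => x _; exact: exprn_even_ge0. Qed.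

Lemma EFin_normal_moment k : (k <= 4)%N ->
  ((mom k)%:E = \int[N01]_x (x ^+ k)%:E)%E.
Proof.
move=> k4; rewrite fineK//; apply: integrable_fin_num => //.
exact: normal_integrable_exp.
Qed.

Lemma normal_moment2_le : mom 2 <= 1.
Proof. by rewrite -lee_fin EFin_normal_moment// normal_moment2. Qed.

Lemma normal_moment4_le : mom 4 <= 3.
Proof. by rewrite -lee_fin EFin_normal_moment// normal_moment4. Qed.

Variables N k : nat.
Local Notation Q := ('I_N * 'I_k)%type.

(** The exponent of z_q in the product z_(m,j) z_(m,i) z_(m',j') z_(m',i). *)
Definition hits (m m' : 'I_N) (i j j' : 'I_k) (q : Q) : nat :=
  (q == (m, j)) + (q == (m, i)) + (q == (m', j')) + (q == (m', i)).

Lemma hits_le4 m m' i j j' q : (hits m m' i j j' q <= 4)%N.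
Proof. by rewrite /hits; do 4 case: (_ == _). Qed.

Lemma prod_hits (z : Q -> R) m m' i j j' :
  \prod_q z q ^+ hits m m' i j j' q =
  z (m, j) * z (m, i) * z (m', j') * z (m', i).
Proof.
have one q0 : \prod_q z q ^+ (q == q0) = z q0.
  rewrite (bigD1 q0)//= eqxx expr1 big1 ?mulr1// => q /negbTE ->.
  by rewrite expr0.
by rewrite -!one -!big_split/=; apply: eq_bigr => q _; rewrite -!exprD.
Qed.

(** Some variable then has the exponent one, and its mean is 0. *)
Lemma moment_hits_off m m' i j j' : j != j' ->
  \prod_q mom (hits m m' i j j' q) = 0.
Proof.
move=> jj'; have zero q0 : hits m m' i j j' q0 = 1%N ->
    \prod_q mom (hits m m' i j j' q) = 0.
  by move=> h; rewrite (bigD1 q0)//= h normal_moment1 mul0r.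
have j'j : (j' == j) = false by rewrite eq_sym (negbTE jj').
have [ji|ji] := eqVneq j i.
  by apply: (zero (m', j')); rewrite /hits -ji !xpair_eqE !eqxx/= j'j !andbF.
apply: (zero (m, j)); rewrite /hits !xpair_eqE !eqxx/=.
by rewrite (negbTE ji) (negbTE jj') !andbF.
Qed.

(** A fourth moment, at most 3, occurs for m = m' and i = j.  If exactly one of
    these equalities holds, the product consists of two second moments; if none
    does, an isolated factor makes it vanish. *)
Lemma moment_hits_le m m' i j :
  \prod_q mom (hits m m' i j j q) <=
  (m == m')%:R + (i == j)%:R * (1 + (m == m')%:R).
Proof.
have even_le1 : (forall q, hits m m' i j j q \in [:: 0%N; 2]) ->
    \prod_q mom (hits m m' i j j q) <= 1.
  move=> h; apply: (@le_trans _ _ (\prod_(q : Q) 1)); last by rewrite big1_eq.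
  apply: ler_prod => q _; have := h q; rewrite !inE => /orP[]/eqP->.
    by rewrite normal_moment0 ler01 lexx.
  by rewrite normal_moment_ge0//= normal_moment2_le.
have [mm'|mm'] := eqVneq m m'; have [ij|ij] := eqVneq i j.
- rewrite (bigD1 (m, j))//= big1 => [|q qmj].
    by rewrite /hits -mm' ij eqxx/= mulr1 (le_trans normal_moment4_le)//; lra.
  by rewrite /hits -mm' ij (negbTE qmj) normal_moment0.
- rewrite mul0r addr0; apply: even_le1 => q; rewrite /hits -mm' !inE.
  have [->|_] := eqVneq q (m, j); last by case: (q == (_, _)).
  by rewrite xpair_eqE eqxx (eq_sym j) (negbTE ij).
- rewrite mul1r addr0 add0r; apply: even_le1 => q; rewrite /hits ij !inE.
  have [->|_] := eqVneq q (m, j); last by case: (q == (_, _)).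
  by rewrite xpair_eqE (negbTE mm').
- rewrite mul0r addr0 (bigD1 (m, j))//= (_ : hits _ _ _ _ _ _ = 1%N).
    by rewrite normal_moment1 mul0r.
  rewrite /hits !xpair_eqE !eqxx/= (negbTE mm') (eq_sym j) (negbTE ij).
  by rewrite !andbF.
Qed.

End FourfoldMoments.

(** * The deterministic estimate on one level *)

Section LevelBound.
Context {R : realFieldType}.
(* The intended values are s_j = t_j^(-1/2), w_i = 1 / gamma_i, N = M_k,
   F j j' = E[1_A g_j g_j'], E the mean of a fourfold product of normal
   variables, p = P(K = k) and l = t_k. *)
Variables (k N : nat) (s w : 'I_k -> R) (F : 'I_k -> 'I_k -> R).
Variable E : 'I_N -> 'I_N -> 'I_k -> 'I_k -> 'I_k -> R.
Variables (p l c : R).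
Hypotheses (p0 : 0 <= p) (l0 : 0 <= l) (c0 : 0 < c).
Hypotheses (F0 : forall j, 0 <= F j j).
Hypotheses (w0 : forall i, 0 <= w i) (ws : forall i, w i <= 2 * s i ^+ 2).
Hypotheses (ls : forall i, l * s i ^+ 2 <= 1).
Hypotheses (Eoff : forall m m' i j j', j != j' -> E m m' i j j' = 0).
Hypotheses (Ediag : forall m m' i j,
  E m m' i j j <= (m == m')%:R + (i == j)%:R * (1 + (m == m')%:R)).
Hypotheses (kN : k%:R <= c * N%:R).

Let S := \sum_j F j j * s j ^+ 2.

Let S0 : 0 <= S.
Proof. by apply: sumr_ge0 => j _; rewrite mulr_ge0// sqr_ge0. Qed.

Lemma sum_pairs_eq (a b : R) :
  \sum_(m < N) \sum_(m' < N) (a * (m == m')%:R + b * (1 + (m == m')%:R)) =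
  N%:R * a + (N%:R ^+ 2 + N%:R) * b.
Proof.
have row (m : 'I_N) : \sum_(m' < N) (m == m')%:R = 1 :> R.
  by rewrite (bigD1 m)//= eqxx big1 ?addr0// => m' /negbTE; rewrite eq_sym => ->.
transitivity (\sum_(m < N) (a + b * (N%:R + 1))).
  apply: eq_bigr => m _; rewrite big_split/= -!mulr_sumr big_split/= row mulr1.
  by rewrite sumr_const card_ord.
by rewrite sumr_const card_ord -mulr_natr; ring.
Qed.

(** The terms with j != j' vanish, and F j j >= 0 allows the bound on E to be
    used in the others. *)
Lemma coord_level_bound i :
  \sum_(m < N) \sum_(m' < N) \sum_j \sum_j'
    s j * s j' * s i ^+ 2 * (p * (F j j' * E m m' i j j')) <=
  p * s i ^+ 2 * (N%:R * S + (N%:R ^+ 2 + N%:R) * (F i i * s i ^+ 2)).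
Proof.
have -> : p * s i ^+ 2 * (N%:R * S + (N%:R ^+ 2 + N%:R) * (F i i * s i ^+ 2)) =
    N%:R * (p * s i ^+ 2 * S) +
    (N%:R ^+ 2 + N%:R) * (p * s i ^+ 2 * (F i i * s i ^+ 2)) by ring.
rewrite -sum_pairs_eq; apply: ler_sum => m _; apply: ler_sum => m' _.
set D := (m == m')%:R.
apply: (@le_trans _ _ (\sum_j (p * s i ^+ 2 * D * (F j j * s j ^+ 2) +
    p * s i ^+ 2 * (1 + D) * ((F j j * s j ^+ 2) * (i == j)%:R)))).
  apply: ler_sum => j _; rewrite (bigD1 j)//= big1 ?addr0 => [|j' j'j]; last first.
    by rewrite Eoff ?mulr0// eq_sym.
  have -> : s j * s j * s i ^+ 2 * (p * (F j j * E m m' i j j)) =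
    (p * s i ^+ 2 * (F j j * s j ^+ 2)) * E m m' i j j by ring.
  have -> : p * s i ^+ 2 * D * (F j j * s j ^+ 2) +
      p * s i ^+ 2 * (1 + D) * (F j j * s j ^+ 2 * (i == j)%:R) =
    (p * s i ^+ 2 * (F j j * s j ^+ 2)) * (D + (i == j)%:R * (1 + D)) by ring.
  apply: ler_wpM2l; last exact: Ediag.
  by apply: mulr_ge0; apply: mulr_ge0; rewrite ?sqr_ge0.
rewrite big_split/= -!mulr_sumr -/S.
have -> : \sum_j F j j * s j ^+ 2 * (i == j)%:R = F i i * s i ^+ 2.
  rewrite (bigD1 i)//= eqxx mulr1 big1 ?addr0// => j ji.
  by rewrite eq_sym (negbTE ji) mulr0.
by rewrite le_eqVlt; apply/orP; left; apply/eqP; ring.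
Qed.

(** Since l s_i^2 <= 1, the i-th summand is at most 2 p / N^2 times
    N S + (N^2 + N) F_ii s_i^2, and these add up to
    2 p (k / N + 1 + 1 / N) S. *)
Lemma level_bound :
  \sum_(i < k) w i * ((l / N%:R) ^+ 2 *
    \sum_(m < N) \sum_(m' < N) \sum_j \sum_j'
      s j * s j' * s i ^+ 2 * (p * (F j j' * E m m' i j j'))) <=
  p * (2 * (1 + 2 * c) * S).
Proof.
have [k0|kpos] := posnP k.
  rewrite big1 => [|i]; last first.
    by case: i => i ik _; exfalso; move: ik; rewrite k0.
  by rewrite !mulr_ge0// addr_ge0// mulr_ge0// ltW.
have k1 : 1 <= k%:R :> R by rewrite ler1n.
have N0 : 0 < N%:R :> R.
  rewrite ltr0n lt0n; apply/negP => /eqP N0.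
  by move: kN; rewrite N0 mulr0 => /(le_trans k1); rewrite ler10.
have N1 : 1 <= c * N%:R by exact: le_trans kN.
have kN' := kN; set n := N%:R in kN' N0 N1 *.
apply: (@le_trans _ _ (\sum_(i < k)
    2 * p / n ^+ 2 * (n * S + (n ^+ 2 + n) * (F i i * s i ^+ 2)))).
  apply: ler_sum => i _.
  set B := n * S + _.
  have B0 : 0 <= B.
    apply: addr_ge0; first by rewrite mulr_ge0// ltW.
    apply: mulr_ge0; first by rewrite addr_ge0 ?sqr_ge0// ltW.
    by rewrite mulr_ge0 ?sqr_ge0.
  apply: (@le_trans _ _ (2 * s i ^+ 2 * ((l / n) ^+ 2 * (p * s i ^+ 2 * B)))).
    apply: (@le_trans _ _ (w i * ((l / n) ^+ 2 * (p * s i ^+ 2 * B)))).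
      by rewrite ler_wpM2l// ler_wpM2l ?sqr_ge0// coord_level_bound.
    apply: ler_wpM2r => //; apply: mulr_ge0; first exact: sqr_ge0.
    by apply: mulr_ge0 => //; rewrite mulr_ge0 ?sqr_ge0.
  have -> : 2 * s i ^+ 2 * ((l / n) ^+ 2 * (p * s i ^+ 2 * B)) =
    (l * s i ^+ 2) ^+ 2 * (2 * p / n ^+ 2 * B) by field; rewrite gt_eqF.
  apply: ler_piMl; first by rewrite mulr_ge0// divr_ge0 ?mulr_ge0 ?sqr_ge0.
  by rewrite expr_le1// mulr_ge0// sqr_ge0.
rewrite -mulr_sumr big_split/= sumr_const card_ord -mulr_sumr -/S.
have -> : 2 * p / n ^+ 2 * (n * S *+ k + (n ^+ 2 + n) * S) =
    p * (2 * (k%:R / n + 1 + n^-1) * S).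
  by rewrite -mulr_natr; field; rewrite gt_eqF.
rewrite ler_wpM2l// ler_wpM2r// ler_wpM2l//.
have : k%:R / n <= c by rewrite ler_pdivrMr.
have : n^-1 <= c by rewrite -[n^-1]mul1r ler_pdivrMr.
lra.
Qed.

End LevelBound.

(** * Independence on one level *)

Section Level.
Context {R : realType} {H : completeNormedModType R}.
Variables (dot : H -> H -> R) (dotP : is_inner_product dot).
Variables (b : nat -> H) (bP : is_prebasis b).
Variables (Rm : forall k, 'M[R]_k) (RmP : forall k, is_QR dot b (Rm k)).
Variables (PK : probability nat R) (PKP : infinite_support_pos PK).
Context {d : measure_display} {Omega : measurableType d}.
Variable P : probability Omega R.
Variables (M : nat -> nat).
Variables (K : nat -> Omega -> nat) (v : nat -> nat -> Omega -> H).
Hypothesis sampling : fgfd_sampling P M K v PK (dir_law PK b Rm).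
Variables n k : nat.

Local Notation e := (gram_schmidt dot b).
Local Notation t := (tail PK).
Local Notation D := (K n @^-1` [set k]).
Local Notation N := (M k).
Local Notation Q := ('I_N * 'I_k)%type.
Local Notation RT := (measurableTypeR R).
Local Notation pastT := (g_sigma_algebraType (past_gen M K v n)).

(** The coordinates of the directions drawn at iteration n, scaled to variance
    one on the level k. *)
Definition dir_coord (q : Q) (x : Omega) : R :=
  dot (v n q.1 x) (e q.2) * Num.sqrt (t q.2.+1).
Local Notation z := dir_coord.

Let mD : measurable D. Proof. exact: (measurable_level sampling). Qed.

Lemma level_prob : P D = PK [set k].
Proof.
have := @fgfd_law _ _ _ _ _ _ _ _ _ _ sampling n setT k (fun=> setT).
have -> : \bigcap_(m < N) v n m @^-1` setT = setT by apply/seteqP; split.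
rewrite setTI setIT probability_setT mul1e => ->//.
- by rewrite big1 ?mule1// => m _; exact: dir_law_setT.
- exact: (@measurableT _ pastT).
- by move=> m; exact: (@measurableT _ (g_sigma_algebraType (@open H))).
Qed.

Lemma measurable_dir_coord q : measurable_fun setT (z q).
Proof.
apply: measurable_funM => //; apply: (borel_coord dotP) => B bB.
exact: (fgfd_measurable_v sampling).
Qed.

(** For each of the countably many l >= k the law of a direction is carried by
    the hyperplane orthogonal to e_l. *)
Lemma level_span m : (m < N)%N ->
  {ae P, forall x, D x -> forall l, (k <= l)%N -> dot (v n m x) (e l) = 0}.
Proof.
move=> mN.
have one l : (k <= l)%N ->
    P.-negligible (D `&` [set x | dot (v n m x) (e l) <> 0]).
  move=> kl.
  pose B (i : nat) := if i == m then [set h | dot h (e l) = 0] else setT.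
  have bB i : borel_H (B i).
    rewrite /B; case: eqP => _; first exact: (borel_dir_orth dotP).
    exact: (@measurableT _ (g_sigma_algebraType (@open H))).
  have := @fgfd_law _ _ _ _ _ _ _ _ _ _ sampling n setT k B.
  rewrite setTI probability_setT mul1e big1 => [|i _]; last first.
    rewrite /B; case: eqP => _; last exact: dir_law_setT.
    exact: (dir_law_orth dotP bP RmP).
  rewrite mule1 -level_prob => /(_ (@measurableT _ pastT) bB).
  set C := \bigcap_(i < N) _ => PDC.
  have mC : measurable C.
    by apply: bigcap_measurableType => i _; exact: (fgfd_measurable_v sampling).
  exists (D `\` C); split.
  - exact: measurableD.
  - have h : (P D < +oo)%E by rewrite (le_lt_trans (probability_le1 _ _))// ltry.
    rewrite measureD// -[RHS](@subee _ (P D)) ?fin_num_measure//.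
    by congr (_ - _)%E; exact: PDC.
  - move=> x [Dx /= vx]; split=> // Cx; apply: vx.
    by have := Cx m mN; rewrite /B/= eqxx.
have : P.-negligible (\bigcup_l (D `&`
    [set x | (k <= l)%N /\ dot (v n m x) (e l) <> 0])).
  apply: negligible_bigcup => l; have [kl|kl] := leqP k l.
    by apply: negligibleS (one l kl) => x [Dx [_ h]].
  rewrite (_ : _ `&` _ = set0); first exact: negligible_set0.
  by apply/seteqP; split=> // x [_ []].
apply: negligibleS => x /= /not_implyP[Dx /existsNP[l /not_implyP[kl vl]]].
by exists l.
Qed.

Section Moments.
Variable f : Omega -> R.
Hypothesis mf : measurable_fun (setT : set pastT) f.
Hypothesis fi : P.-integrable setT (EFin \o f).

Let mfO : measurable_fun setT f.
Proof.
exact: (sub_sigma_measurable_fun (past_gen_measurable sampling (n := n))).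
Qed.

(* The index inl tt stands for the variable f of the past. *)
Let X (q : unit + Q) : Omega -> RT :=
  match q with inl _ => f | inr q => z q end.

Let fM : {mfun Omega >-> RT} :=
  HB.pack f (isMeasurableFun.Build _ _ Omega RT f mfO).

Let law (q : unit + Q) : probability RT R :=
  match q with inl _ => distribution P fM | inr _ => normal_prob 0 1 end.

(** A box in the coordinates is a product of events for the single directions,
    to which the sampling law applies; the law of a direction factorizes in turn
    over its coordinates. *)
Let level_indep (B : unit + Q -> set RT) : (forall q, measurable (B q)) ->
  (P (D `&` \bigcap_q X q @^-1` B q) =
   (fine (PK [set k]))%:E * \prod_q law q (B q))%E.
Proof.
move=> mB.
pose B' m := if @insub nat (fun m => m < N)%N 'I_N m is Some m' then
  dir_box dot b PK (fun j => B (inr (m', j))) else setT.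
have bB' m : borel_H (B' m).
  rewrite /B'; case: insub => [m'|]; last first.
    exact: (@measurableT _ (g_sigma_algebraType (@open H))).
  exact: borel_dir_box.
have -> : D `&` \bigcap_q X q @^-1` B q = f @^-1` B (inl tt) `&` D `&`
    \bigcap_(m < N) v n m @^-1` B' m.
  apply/seteqP; split=> x.
    move=> [Dx XB]; split; first by split=> //; exact: (XB (inl tt)).
    move=> m /= mN; rewrite /B' insubT => j.
    exact: (XB (inr (Ordinal mN, j))).
  move=> [[fB Dx] vB]; split=> // -[[]|[m j]] _ //=.
  by have := vB m (ltn_ord m); rewrite /B' /= valK => /(_ j).
rewrite (fgfd_law sampling)//; last first.
  by have := mf measurableT (mB (inl tt)); rewrite setTI.
rewrite big_sumType/= (big_pred1 tt)/=; last by case.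
rewrite fineK ?fin_num_measure// muleA [X in (X * _)%E]muleC; congr (_ * _)%E.
transitivity (\prod_(m < N) \prod_(j < k) normal_prob 0 1 (B (inr (m, j))))%E.
  by apply: eq_bigr => m _; rewrite /B' valK (dir_law_box dotP bP RmP PKP).
by rewrite pair_bigA/=; apply: eq_bigr => -[m j].
Qed.

Variable a : Q -> nat.
Hypothesis a4 : forall q, (a q <= 4)%N.

Let phi (q : unit + Q) (y : R) : R :=
  match q with inl _ => y | inr q => y ^+ a q end.

Let mphi q : measurable_fun (setT : set RT) (phi q).
Proof. by case: q => [u|q]; [exact: measurable_id|exact: exprn_measurable]. Qed.

Let iphi q : (law q).-integrable setT (EFin \o phi q).
Proof.
case: q => [u|q] /=; last exact: normal_integrable_exp.
by apply: (@integrable_pushforward _ _ Omega RT R f mfO P setT EFin).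
Qed.

Let prodE x : \prod_q phi q (X q x) = f x * \prod_q z q x ^+ a q.
Proof. by rewrite big_sumType/= (big_pred1 tt)//; case. Qed.

Lemma integrable_level :
  P.-integrable D (EFin \o (fun x => f x * \prod_q z q x ^+ a q)).
Proof.
have mX q : measurable_fun setT (X q).
  by case: q => [u|q]; [exact: mfO|exact: measurable_dir_coord].
have := integrable_prod_indep mD mX level_indep mphi iphi.
by apply: eq_integrable => // x _ /=; rewrite prodE.
Qed.

Lemma integral_level :
  \int[P]_(x in D) (f x * \prod_q z q x ^+ a q) =
  fine (PK [set k]) * ((\int[P]_x f x) * \prod_q @normal_moment R (a q)).
Proof.
have mX q : measurable_fun setT (X q).
  by case: q => [u|q]; [exact: mfO|exact: measurable_dir_coord].
have := integral_prod_indep mD mX level_indep mphi iphi.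
under eq_Rintegral do rewrite prodE.
move=> ->; congr (_ * _); rewrite big_sumType/= (big_pred1 tt)/=; last by case.
congr (_ * _); rewrite /Rintegral.
congr fine.
by apply: (@integral_pushforward _ _ Omega RT R f mfO P setT EFin).
Qed.

End Moments.

End Level.

(** * The mean squared norm on one level *)

Section HasIntegral.
Context {R : realType} {d : measure_display} {T : measurableType d}.
Variables (P : probability T R) (D : set T) (mD : measurable D).

(** Integrability and value are carried along together, since computing the
    integral of a sum takes the integrability of its terms. *)
Definition has_int (F : T -> R) (r : R) : Prop :=
  P.-integrable D (EFin \o F) /\ \int[P]_(x in D) F x = r.

Lemma has_intZ a F r : has_int F r -> has_int (fun x => a * F x) (a * r).
Proof.
move=> [iF <-]; split; last exact: RintegralZl.
by have := integrableZl mD a iF.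
Qed.

Lemma has_int_sum n (F : 'I_n -> T -> R) (r : 'I_n -> R) :
  (forall i, has_int (F i) (r i)) ->
  has_int (fun x => \sum_i F i x) (\sum_i r i).
Proof.
move=> FP.
have iF : P.-integrable D (fun x => \sum_(i < n) (F i x)%:E)%E.
  by apply: integrable_sum => // i _; case: (FP i).
have sE : EFin \o (fun x => \sum_(i < n) F i x) =
    (fun x => \sum_(i < n) (F i x)%:E)%E.
  by apply/funext => x /=; rewrite sumEFin.
split; first by rewrite sE.
rewrite /Rintegral.
under eq_integral do rewrite -sumEFin.
rewrite integral_sum//; last by move=> i; case: (FP i).
rewrite (_ : \sum_(i < n) _ = (\sum_(i < n) r i)%:E)%E// -sumEFin.
apply: eq_bigr => i _; have [iFi <-] := FP i.
by rewrite /Rintegral fineK// integrable_fin_num.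
Qed.

End HasIntegral.

Section LevelEstimate.
Context {R : realType} {H : completeNormedModType R}.
Variables (dot : H -> H -> R) (dotP : is_inner_product dot).
Variables (b : nat -> H) (bP : is_prebasis b).
Variables (Rm : forall k, 'M[R]_k) (RmP : forall k, is_QR dot b (Rm k)).
Variables (PK : probability nat R) (PKP : infinite_support_pos PK).
Variables (Rf : H -> R) (grad : H -> H) (gradP : is_gradient dot Rf grad).
Context {d : measure_display} {Omega : measurableType d}.
Variable P : probability Omega R.
Variables (M : nat -> nat) (alpha : nat -> R) (h1 : H).
Variables (K : nat -> Omega -> nat) (v : nat -> nat -> Omega -> H).
Hypothesis sampling : fgfd_sampling P M K v PK (dir_law PK b Rm).
Variables (c : R) (c0 : 0 < c).
Variables n k : nat.
Hypothesis kM : k%:R <= c * (M k)%:R.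

Local Notation e := (gram_schmidt dot b).
Local Notation t := (tail PK).
Local Notation gam := (gamma PK t).
Local Notation D := (K n @^-1` [set k]).
Local Notation N := (M k).
Local Notation Q := ('I_N * 'I_k)%type.
Local Notation pastT := (g_sigma_algebraType (past_gen M K v n)).
Local Notation iter := (fgfd_iter Rf t M alpha h1 K v).
Local Notation ghat := (fgfd_ghat Rf t M alpha h1 K v n).
Local Notation z := (@dir_coord R H dot b PK d Omega M v n k).
Local Notation g := (fun j x => dot (grad (iter n x)) (e j)).

Let eP : orthonormal_seq dot e := gram_schmidt_orthonormal dotP bP RmP.
Let e_dense : dense_span e := gram_schmidt_dense bP RmP.

Let mD : measurable D. Proof. exact: (measurable_level sampling). Qed.

Variables (A : set Omega) (L : R).
Hypothesis pA : past M K v n A.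
Hypothesis gL : forall x, A x -> `|grad (iter n x)| <= L.

(** The products of coordinates of the gradient are signed; cutting down to an
    event A on which the gradient is bounded makes them integrable. *)
Definition grad_prod (j j' : nat) (x : Omega) : R := \1_A x * (g j x * g j' x).

Let mgrad_prod j j' : measurable_fun (setT : set pastT) (grad_prod j j').
Proof.
apply: measurable_funM; first exact: (@measurable_indic _ pastT).
by apply: measurable_funM; exact: (measurable_grad_coord dotP eP e_dense gradP).
Qed.

Let mA : measurable A. Proof. exact: (past_measurable sampling pA). Qed.

Lemma integrable_grad_prod j j' : P.-integrable setT (EFin \o grad_prod j j').
Proof.
apply: (@le_integrable _ _ _ P _ _ _ (cst (L ^+ 2)%:E)) => //.
- apply/measurable_EFinP.
  exact: (sub_sigma_measurable_fun (past_gen_measurable sampling (n := n))).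
- move=> x _; rewrite /= lee_fin [leRHS]ger0_norm ?sqr_ge0// /grad_prod indicE.
  have [|_] := boolP (x \in A); last by rewrite mul0r normr0 sqr_ge0.
  rewrite inE => Ax; rewrite mul1r normrM expr2.
  have bound i : `|g i x| <= L.
    apply: le_trans (cauchy_schwarz dotP _ _) _.
    have -> : `|e i| = 1.
      by apply/eqP; rewrite -(@eqrXn2 _ 2)// -(dot_norm dotP) eP eqxx expr1n.
    by rewrite mulr1; exact: gL.
  by rewrite ler_pM.
- exact: finite_measure_integrable_cst.
Qed.

Let F (j j' : 'I_k) : R := \int[P]_x grad_prod j j' x.

Let p : R := fine (PK [set k]).
Let s (j : 'I_k) : R := (Num.sqrt (t j.+1))^-1.

Let s2E j : s j ^+ 2 = (t j.+1)^-1.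
Proof. by rewrite /s exprVn sqr_sqrtr// tail_ge0. Qed.

Let Phi x : R := \sum_(i < k) (gam i.+1)^-1 * ((t k / N%:R) ^+ 2 *
  \sum_(m < N) \sum_(m' < N) \sum_(j < k) \sum_(j' < k)
    s j * s j' * s i ^+ 2 * (grad_prod j j' x *
      \prod_q z q x ^+ hits m m' i j j' q)).

Let has_int_Phi : has_int P D Phi (\sum_(i < k) (gam i.+1)^-1 *
  ((t k / N%:R) ^+ 2 *
  \sum_(m < N) \sum_(m' < N) \sum_(j < k) \sum_(j' < k)
    s j * s j' * s i ^+ 2 * (p * (F j j' *
      \prod_q @normal_moment R (hits m m' i j j' q))))).
Proof.
apply: has_int_sum => // i; do 2 apply: has_intZ => //.
do 2 (apply: has_int_sum => // ?); do 2 (apply: has_int_sum => // ?).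
apply: has_intZ => //; split.
  apply: (integrable_level dotP bP RmP PKP sampling (mgrad_prod _ _)).
    exact: integrable_grad_prod.
  by move=> q; exact: hits_le4.
apply: (integral_level dotP bP RmP PKP sampling (mgrad_prod _ _)).
  exact: integrable_grad_prod.
by move=> q; exact: hits_le4.
Qed.

Let gam_gt0 i : 0 < gam i.
Proof.
by apply: lt_le_trans (gamma_tail_ge PKP i); rewrite divr_gt0// tail_gt0.
Qed.

(** Expansion of the squared norm of the estimate into products of the
    coordinates of the directions, which span no more than e_0, ..., e_(k-1). *)
Let normC2_level x : D x ->
  (forall m, (m < N)%N -> forall l, (k <= l)%N -> dot (v n m x) (e l) = 0) ->
  ((\1_A x)%:E * normC2 e dot gam (ghat x) = (Phi x)%:E)%E.
Proof.
move=> Dx vspan.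
have dotv m j : dot (v n (m : 'I_N) x) (e (j : 'I_k)) = s j * z (m, j) x.
  rewrite /dir_coord /s /= mulrCA mulVf ?mulr1// gt_eqF// sqrtr_gt0.
  exact: tail_gt0.
have dotg (m : 'I_N) : dot (grad (iter n x)) (v n m x) =
    \sum_(j < k) s j * z (m, j) x * g j x.
  rewrite [X in dot _ X](sum_proj_eq dotP eP e_dense (vspan m (ltn_ord m))).
  rewrite (dot_sumr dotP); apply: eq_bigr => j _.
  by rewrite (dotZr dotP) dotv.
have ghatx : ghat x = (t k / N%:R) *:
    \sum_(m < N) dot (grad (iter n x)) (v n m x) *: v n m x.
  rewrite /fgfd_ghat /fgfd_grad Dx; congr (_ *: _).
  by apply: eq_bigr => m _; rewrite (derive_grad gradP).
have dotgh l : dot (ghat x) (e l) = (t k / N%:R) *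
    \sum_(m < N) dot (grad (iter n x)) (v n m x) * dot (v n m x) (e l).
  rewrite ghatx (dotZl dotP) (dot_suml dotP); congr (_ * _).
  by apply: eq_bigr => m _; rewrite (dotZl dotP).
rewrite /normC2 (nneseries_split 0 k)//=; last first.
  by move=> i _; rewrite lee_fin divr_ge0 ?sqr_ge0// ltW.
rewrite add0n eseries0 ?adde0; last first.
  move=> i ki _; rewrite dotgh big1 ?mulr0 ?expr0n ?mul0r// => m _.
  by rewrite vspan ?mulr0.
rewrite sumEFin -EFinM big_mkord; congr (_%:E); rewrite mulr_sumr.
apply: eq_bigr => i _; rewrite mulrA mulrC; congr (_ * _).
rewrite dotgh exprMn mulrCA; congr (_ * _).
rewrite expr2 big_distrlr/= mulr_sumr; apply: eq_bigr => m _.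
rewrite mulr_sumr; apply: eq_bigr => m' _.
have am m0 : dot (grad (iter n x)) (v n (m0 : 'I_N) x) * dot (v n m0 x) (e i) =
    \sum_(j < k) s j * z (m0, j) x * g j x * (s i * z (m0, i) x).
  by rewrite dotg dotv mulr_suml.
rewrite !am big_distrlr/= mulr_sumr; apply: eq_bigr => j _.
rewrite mulr_sumr; apply: eq_bigr => j' _.
rewrite prod_hits /grad_prod; ring.
Qed.

Let measurable_normC2 :
  measurable_fun setT (fun x => normC2 e dot gam (ghat x)).
Proof.
apply: ge0_emeasurable_sum => [i x _ _|i _].
  by rewrite lee_fin divr_ge0 ?sqr_ge0// ltW.
apply/measurable_EFinP; apply: measurable_funM => //; apply: measurable_funX.
exact: (measurable_ghat_coord dotP eP e_dense gradP t alpha h1 sampling).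
Qed.

(** By independence the mean of the expansion [Phi] is the deterministic sum
    estimated in [level_bound]. *)
Lemma integral_ghat_level_le :
  (\int[P]_(x in A `&` D) normC2 e dot gam (ghat x) <=
   PK [set k] * (2 * (1 + 2 * c) *
     \sum_(j < k) (\int[P]_x grad_prod j j x) / t j.+1)%:E)%E.
Proof.
have n0 x : (0 <= normC2 e dot gam (ghat x))%E.
  by apply: nneseries_ge0 => i _ _; rewrite lee_fin divr_ge0 ?sqr_ge0// ltW.
have mAi : measurable_fun D (fun x => ((\1_A x)%:E : \bar R)).
  by apply/measurable_EFinP; exact: measurable_indic.
have -> : (\int[P]_(x in A `&` D) normC2 e dot gam (ghat x) =
    \int[P]_(x in D) ((\1_A x)%:E * normC2 e dot gam (ghat x)))%E.
  rewrite setIC integral_mkcondr; apply: eq_integral => x _.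
  by rewrite patchE indicE; case: (x \in A); rewrite ?mul1e ?mul0e.
have [iPhi vPhi] := has_int_Phi.
have -> : (\int[P]_(x in D) ((\1_A x)%:E * normC2 e dot gam (ghat x)) =
    \int[P]_(x in D) (Phi x)%:E)%E.
  apply: ae_eq_integral => //.
  - by apply: emeasurable_funM => //; exact: measurable_funTS.
  - exact: measurable_int iPhi.
  - have : {ae P, forall x, forall m : 'I_N, D x -> forall l, (k <= l)%N ->
        dot (v n m x) (e l) = 0}.
      apply: filter_forall => m.
      exact: (level_span dotP bP RmP sampling n (ltn_ord m)).
    apply: filterS => x vx Dx; apply: normC2_level => // m mN.
    exact: (vx (Ordinal mN)).
rewrite -[leLHS]fineK ?integrable_fin_num// -/(Rintegral _ _ _) vPhi.
rewrite -[PK _]fineK ?fin_num_measure// -EFinM lee_fin.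
under [X in _ <= _ * (_ * X)]eq_bigr do rewrite -s2E.
apply: level_bound => //.
- by rewrite fine_ge0.
- exact: tail_ge0.
- move=> j; apply: Rintegral_ge0 => x _; rewrite /grad_prod -expr2.
  by rewrite mulr_ge0// sqr_ge0.
- by move=> i; rewrite invr_ge0 ltW.
- move=> i; rewrite s2E -[leRHS]invrK lef_pV2 ?posrE ?invr_gt0//.
    by rewrite invfM invrK mulrC; exact: gamma_tail_ge.
  by rewrite mulr_gt0// invr_gt0 tail_gt0.
- move=> i; rewrite s2E ler_pdivrMr ?tail_gt0// mul1r; exact: tail_nincr.
- by move=> *; exact: moment_hits_off.
- by move=> *; exact: moment_hits_le.
Qed.

End LevelEstimate.

(** * From integrals over the past to conditional expectations *)

(** The event E > h is the union of the events B_j on which moreover h <= j.  On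
    B_j the integral of h is finite and dominates that of X, which is that of
    E; hence the positive function E - h has integral 0 there, and B_j is
    negligible. *)
Lemma cond_exp_le (R : realType) (d : measure_display) (T : measurableType d)
  (P : probability T R) (G : set (set T)) (X E : T -> \bar R) (h : T -> R) :
  G `<=` measurable -> is_cond_exp P <<s G >> X E -> (forall x, 0 <= h x) ->
  measurable_fun (setT : set (g_sigma_algebraType G)) h ->
  (forall A L, <<s G >> A -> (forall x, A x -> h x <= L) ->
    (\int[P]_(x in A) X x <= \int[P]_(x in A) (h x)%:E)%E) ->
  {ae P, forall x, (E x <= (h x)%:E)%E}.
Proof.
move=> GT [E0 mE intE] h0 mh Xh.
have mET : measurable_fun (setT : set (g_sigma_algebraType G)) E.
  by move=> _ B mB; rewrite setTI; exact: mE.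
pose B (j : nat) : set T :=
  [set x | ((h x)%:E < E x)%E] `&` [set x | h x <= j%:R].
have GB j : <<s G >> (B j).
  apply: (@measurableI _ (g_sigma_algebraType G)).
    rewrite -[X in _ X]setTI; apply: measurable_lte => //.
    exact/measurable_EFinP.
  rewrite -[X in _ X]setTI.
  have -> : [set x | h x <= j%:R] = h @^-1` `]-oo, j%:R].
    by apply/seteqP; split=> x /=; rewrite in_itv.
  exact: mh.
have mB j : measurable (B j) by exact: sub_sigma_measurable (GB j).
have mE' : measurable_fun setT E by exact: (sub_sigma_measurable_fun GT).
have mh' : measurable_fun setT h by exact: (sub_sigma_measurable_fun GT).
pose E' x := (E x - (h x)%:E)%E.
have mE'' : measurable_fun setT E'.
  by apply: emeasurable_funB => //; exact/measurable_EFinP.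
have negB j : P.-negligible (B j).
  have E'0 x : B j x -> (0 < E' x)%E by move=> [/= hE _]; rewrite sube_gt0.
  have ih : P.-integrable (B j) (EFin \o h).
    apply: (@le_integrable _ _ _ P _ _ _ (cst (j%:R)%:E)) => //.
    - exact/measurable_EFinP/measurable_funTS.
    - move=> x [_ /= hj]; rewrite lee_fin !ger0_norm//.
    - exact: finite_measure_integrable_cst.
  have fh : (\int[P]_(x in B j) (h x)%:E)%E \is a fin_num.
    exact: integrable_fin_num.
  have : (\int[P]_(x in B j) E' x = 0)%E.
    apply/eqP; rewrite eq_le integral_ge0 ?andbT; last first.
      by move=> x /E'0/ltW.
    have : (\int[P]_(x in B j) E x <= \int[P]_(x in B j) (h x)%:E)%E.
      by rewrite intE//; apply: (Xh _ j%:R) => // x [].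
    rewrite (_ : \int[P]_(x in B j) E x =
      \int[P]_(x in B j) (h x)%:E + \int[P]_(x in B j) E' x)%E.
      by rewrite -leeBrDl// subee.
    rewrite -ge0_integralD//.
    - by apply: eq_integral => x _; rewrite /E' addeC subeK.
    - by move=> x _; rewrite lee_fin.
    - exact/measurable_EFinP/measurable_funTS.
    - by move=> x /E'0/ltW.
    - exact: measurable_funTS.
  have eqa : (\int[P]_(x in B j) `|E' x| = \int[P]_(x in B j) E' x)%E.
    by apply: eq_integral => x; rewrite inE => /E'0/ltW/gee0_abs.
  rewrite -eqa => /ae_eq_integral_abs[]//; first exact: measurable_funTS.
  move=> N [mN PN0 sN]; exists N; split=> // x Bx; apply: sN => /= /(_ Bx).
  by move=> E'x; have := E'0 _ Bx; rewrite E'x ltxx.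
apply: negligibleS (negligible_bigcup negB) => x /= /negP; rewrite -ltNge => hE.
exists (Num.truncn (h x)).+1 => //; split=> //=.
exact/ltW/truncnS_gt.
Qed.

Section Past.
Context {R : realType} {H : completeNormedModType R}.
Variables (dot : H -> H -> R) (dotP : is_inner_product dot).
Variables (b : nat -> H) (bP : is_prebasis b).
Variables (Rm : forall k, 'M[R]_k) (RmP : forall k, is_QR dot b (Rm k)).
Variables (PK : probability nat R) (PKP : infinite_support_pos PK).
Variables (Rf : H -> R) (grad : H -> H) (gradP : is_gradient dot Rf grad).
Context {d : measure_display} {Omega : measurableType d}.
Variable P : probability Omega R.
Variables (M : nat -> nat) (alpha : nat -> R) (h1 : H).
Variables (K : nat -> Omega -> nat) (v : nat -> nat -> Omega -> H).
Hypothesis sampling : fgfd_sampling P M K v PK (dir_law PK b Rm).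
Variables (c : R) (c0 : 0 < c).
Hypothesis kM : forall k, k%:R <= c * (M k)%:R.
Variable n : nat.

Local Notation e := (gram_schmidt dot b).
Local Notation t := (tail PK).
Local Notation gam := (gamma PK t).
Local Notation iter := (fgfd_iter Rf t M alpha h1 K v).
Local Notation ghat := (fgfd_ghat Rf t M alpha h1 K v n).

Let eP : orthonormal_seq dot e := gram_schmidt_orthonormal dotP bP RmP.
Let e_dense : dense_span e := gram_schmidt_dense bP RmP.

(** Summing the estimates of the levels restores the squared norm of the
    gradient, by [sum_tail] and the Parseval identity. *)
Lemma integral_ghat_le A L : past M K v n A ->
  (forall x, A x -> `|grad (iter n x)| <= L) ->
  (\int[P]_(x in A) normC2 e dot gam (ghat x) <=
   \int[P]_(x in A) (2 * (1 + 2 * c) * `|grad (iter n x)| ^+ 2)%:E)%E.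
Proof.
move=> pA gL.
have mA : measurable A by exact: (past_measurable sampling pA).
have mD k : measurable (K n @^-1` [set k]) by exact: (measurable_level sampling).
have gam_ge0 i : 0 <= gam i.
  by apply: le_trans (gamma_tail_ge PKP i); rewrite divr_ge0// tail_ge0.
have C0 : 0 <= 2 * (1 + 2 * c) by rewrite mulr_ge0// addr_ge0// mulr_ge0// ltW.
pose f j x := grad_prod dot b PK Rf grad M alpha h1 K v n A j j x.
have f0 j x : 0 <= f j x by rewrite /f /grad_prod mulr_ge0// -expr2 sqr_ge0.
have if_ j : P.-integrable setT (EFin \o f j).
  exact: (integrable_grad_prod dotP bP RmP gradP sampling pA gL).
pose G j := \int[P]_x f j x.
have G0 j : 0 <= G j by exact: Rintegral_ge0.
have -> : (\int[P]_(x in A) normC2 e dot gam (ghat x) =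
    \sum_(0 <= k <oo) \int[P]_(x in A `&` K n @^-1` [set k])
      normC2 e dot gam (ghat x))%E.
  rewrite -ge0_integral_bigcup/=.
  - rewrite -setI_bigcupr -preimage_bigcup bigcup_imset1 image_id.
    by rewrite preimage_setT setIT.
  - by move=> k; exact: measurableI.
  - apply: measurable_funTS; apply: ge0_emeasurable_sum => [i x _ _|i _].
      by rewrite lee_fin divr_ge0 ?sqr_ge0.
    apply/measurable_EFinP; apply: measurable_funM => //; apply: measurable_funX.
    exact: (measurable_ghat_coord dotP eP e_dense gradP t alpha h1 sampling).
  - move=> x _; apply: nneseries_ge0 => i _ _.
    by rewrite lee_fin divr_ge0 ?sqr_ge0.
  - apply/trivIsetP => i j _ _ ij; apply/seteqP; split=> // x.
    by move=> [[_ /= xi] [_ /= xj]]; rewrite -xi -xj eqxx in ij.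
have sumG : (\sum_(0 <= j <oo) (2 * (1 + 2 * c) * G j)%:E =
    \int[P]_(x in A) (2 * (1 + 2 * c) * `|grad (iter n x)| ^+ 2)%:E)%E.
  transitivity (\sum_(0 <= j <oo) \int[P]_x (2 * (1 + 2 * c) * f j x)%:E)%E.
    apply: eq_eseriesr => j _; under eq_integral do rewrite EFinM.
    rewrite integralZl//; last exact: if_.
    rewrite EFinM; congr (_ * _)%E.
    by rewrite fineK//; apply: integrable_fin_num => //; exact: if_.
  rewrite -integral_nneseries//; last 2 first.
  - move=> j; apply/measurable_EFinP; apply: measurable_funM => //.
    exact/measurable_EFinP/(measurable_int _ (if_ j)).
  - by move=> j x _; rewrite lee_fin mulr_ge0.
  rewrite [RHS]integral_mkcond; apply: eq_integral => x _.
  rewrite patchE; apply/cvg_lim => //.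
  have cv := cvg_parseval dotP eP e_dense (x := grad (iter n x)).
  have -> : (fun N => \sum_(0 <= j < N) (2 * (1 + 2 * c) * f j x)%:E)%E =
      (fun N => (2 * (1 + 2 * c) * (\1_A x *
        \sum_(j < N) dot (grad (iter n x)) (e j) ^+ 2))%:E).
    apply/funext => N; rewrite sumEFin big_mkord !mulr_sumr; congr (_%:E).
  rewrite indicE; case: ifPn => Ax.
    apply: cvg_EFin; first exact: nearW.
    by under eq_fun do rewrite mul1r; exact: cvgMr.
  under eq_fun do rewrite mul0r mulr0.
  exact: cvg_cst.
rewrite -sumG.
have -> : (\sum_(0 <= j <oo) (2 * (1 + 2 * c) * G j)%:E =
    \sum_(0 <= j <oo) (2 * (1 + 2 * c) * G j / t j.+1 * t j.+1)%:E)%E.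
  by apply: eq_eseriesr => j _; rewrite divfK// gt_eqF// tail_gt0.
rewrite -(sum_tail _ (w := fun j => 2 * (1 + 2 * c) * G j / t j.+1)); last first.
  by move=> j; rewrite divr_ge0 ?tail_ge0// mulr_ge0.
apply: lee_nneseries => [k _ _|k _].
  apply: integral_ge0 => x _; apply: nneseries_ge0 => i _ _.
  by rewrite lee_fin divr_ge0 ?sqr_ge0.
have := integral_ghat_level_le dotP bP RmP PKP gradP sampling c0 (kM k) pA gL.
by rewrite mulr_sumr; under eq_bigr do rewrite mulrA.
Qed.

End Past.

Theorem corollary2 (R : realType) (H : completeNormedModType R)
  (dot : H -> H -> R) (dotP : is_inner_product dot)
  (Rf : H -> R) (grad : H -> H) (gradP : is_gradient dot Rf grad)
  (b : nat -> H) (bP : is_prebasis b)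
  (Rm : forall k, 'M[R]_k) (RmP : forall k, is_QR dot b (Rm k))
  (PK : probability nat R) (PKP : infinite_support_pos PK)
  (c : R) (c_gt0 : 0 < c)
  (alpha : nat -> R) (alpha_gt0 : forall n, 0 < alpha n)
  (h1 : H) :
  let e := gram_schmidt dot b in
  let lam := tail PK in
  let M := fun k : nat => `|Num.ceil (k%:R / c)|%N in
  let gam := gamma PK lam in
  C12_range e dot gam h1 ->
  forall (d : measure_display) (Omega : measurableType d)
    (P : probability Omega R)
    (K : nat -> Omega -> nat) (v : nat -> nat -> Omega -> H),
  fgfd_sampling P M K v PK (dir_law PK b Rm) ->
  forall (n : nat) (E : Omega -> \bar R),
  is_cond_exp P (sigma_iter Rf lam M alpha h1 K v n)
    (fun x => normC2 e dot gam (fgfd_ghat Rf lam M alpha h1 K v n x)) E ->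
  {ae P, forall x, (E x <=
    (2 * (1 + 2 * c) * `|grad (fgfd_iter Rf lam M alpha h1 K v n x)| ^+ 2)%:E)%E}.
Proof.
move=> e lam M gam _ d Omega P K v sampling n E EP.
have kM k : k%:R <= c * (M k)%:R.
  rewrite mulrC -ler_pdivrMr// (le_trans (real_ceil_ge (num_real _)))//.
  by rewrite natr_absz ler_int ler_norm.
have eP := gram_schmidt_orthonormal dotP bP RmP.
have e_dense := gram_schmidt_dense bP RmP.
have C0 : 0 < 2 * (1 + 2 * c) by rewrite mulr_gt0// addr_gt0// mulr_gt0.
set G := [set A | exists j B, [/\ (j <= n)%N, borel_H B
  & A = fgfd_iter Rf lam M alpha h1 K v j @^-1` B]].
have GT : G `<=` measurable.
  move=> A GA; apply: (past_measurable sampling (n := n)).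
  apply: (sigma_iter_past dotP eP e_dense gradP).
  exact: (@sub_sigma_algebra _ setT G A GA).
apply: (cond_exp_le GT EP).
- by move=> x; rewrite mulr_ge0 ?sqr_ge0// ltW.
- apply: measurable_funM => //; apply: (measurable_normsq dotP eP e_dense).
  apply: (coord_measurable_grad dotP eP e_dense gradP); apply: (borel_coord dotP).
  by move=> B bB; apply: sub_sigma_algebra; exists n, B.
(* The bound L on 2 (1 + 2 c) |g|^2 is turned into one on |g|. *)
move=> A L GA AL.
apply: (integral_ghat_le dotP bP RmP PKP gradP sampling c_gt0 kM
  (L := Num.sqrt (L / (2 * (1 + 2 * c))))).
  exact: (sigma_iter_past dotP eP e_dense gradP GA).
move=> x Ax; rewrite -[leLHS]ger0_norm// -sqrtr_sqr ler_wsqrtr//.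
by rewrite ler_pdivlMr// mulrC; exact: AL.
Qed.
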